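(* In the setting described in the context, assume the problem is mildly ill-posed, i.e. $a_k\asymp k^{-p}$ as $k\to\infty$ for some $p>0$, let $\beta>0$ with $\beta+p>1/2$, and take the prior variances $\lambda_k=\rho_n^2k^{-1-2\alpha}$ with $\alpha>0$ and any positive sequence $\rho_n$ with $\rho_n^2n\to\infty$. Then for any $K>0$ and any sequence $M_n\to\infty$, \[\sup_{f_0\in S^\beta:\|f_0\|_\beta\le K}\mathbb{E}_{f_0}\Pi_n\big(f:\|f-f_0\|_{H_1}\ge M_n\varepsilon_n\mid U^n\big)\to 0,\] where \[\varepsilon_n=\varepsilon_{n,1}\vee\varepsilon_{n,2}=(\rho_n^2n)^{-\beta/(2\alpha+2p+1)\wedge 1}\vee \rho_n(\rho_n^2n)^{-\alpha/(2\alpha+2p+1)}.\] In particular: (i) if $\rho_n=1$, then $\varepsilon_n=n^{-(\alpha\wedge\beta)/(2\alpha+2p+1)}$; (ii) if $\beta\le 2\alpha+2p+1$ and $\rho_n\asymp n^{(\alpha-\beta)/(2\beta+2p+1)}$, then $\varepsilon_n=n^{-\beta/(2\beta+2p+1)}$; (iii) if $\beta>2\alpha+2p+1$, then for every scaling $\rho_n$, $\varepsilon_n\gg n^{-\beta/(2\beta+2p+1)}$.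
   Context: Let $H_1,H_2\subset L^2([0,1])$ be Hilbert spaces of functions on $[0,1]$ and $A:H_1\to H_2$ an injective compact linear operator. Let $\{\varphi_k\}_{k\ge1}$ be an orthonormal eigenbasis of $A^*A$ in $H_1$, $A^*A\varphi_k=a_k^2\varphi_k$ with $a_k>0$, and let $\psi_k:=A\varphi_k/a_k$ (an orthonormal system, $A\varphi_k=a_k\psi_k$). For $f\in H_1$ write $f_k=\langle f,\varphi_k\rangle$, identify $f$ with $(f_k)_k$, so $\|f\|_{H_1}^2=\sum_kf_k^2$. For $\beta\ge0$, $S^\beta$ is the set of $f=\sum_kf_k\varphi_k$ with $\|f\|_\beta:=(\sum_k f_k^2k^{2\beta})^{1/2}<\infty$. Observations: for $n\ge2$, design points $x_i=i/n$, and $Y_i=Af(x_i)+\xi_i$, $i=1,\dots,n$, with $\xi_i$ i.i.d. $\mathcal N(0,1)$ ($Af$ continuous). Put $\langle g,h\rangle_d:=\frac1n\sum_{i=1}^ng(x_i)h(x_i)$. Standing assumption on the conjugate basis: (i) $\langle\psi_j,\psi_k\rangle_d=\delta_{jk}$ for $1\le j,k\le n-1$; (ii) for $1\le k\le n-1$ and fixed $l\in\mathbb N$, among $j\in\{ln,\dots,(l+1)n-1\}$ there is exactly one $\tilde j=ln+\bar k$ ($\bar k$ depending only on the parity of $l$) with $0<|\langle\psi_{\tilde j},\psi_k\rangle_d|<M$ for a fixed constant $M$, and $\langle\psi_j,\psi_k\rangle_d=0$ for all other such $j$. Transformed data: $U_k:=\frac1n\sum_{i=1}^nY_i\psi_k(x_i)$,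 $k=1,\dots,n-1$, $U^n=(U_1,\dots,U_{n-1})$; thus $U_k=a_kf_k+R_k(f)+\zeta_k/\sqrt n$ with $R_k(f)=\langle A\sum_{j\ge n}f_j\varphi_j,\psi_k\rangle_d$ and $\zeta_k=n^{-1/2}\sum_{i=1}^n\xi_i\psi_k(x_i)$. $\mathbb E_{f_0}$ (resp. $\mathbb P_{f_0}$) denotes expectation (probability) when the data are generated with $f=f_0$. Prior: $f_k\sim\mathcal N(0,\lambda_k)$ independently for $k<n$, $f_k=0$ for $k\ge n$, independent of the noise. The posterior is $\Pi_n(\cdot\mid U^n)=\bigotimes_{k\in\mathbb N}\mathcal N(\hat f_k,\sigma_k^2)$ (on coefficients) with $\hat f_k=\frac{na_k\lambda_k\mathbf 1\{k<n\}}{na_k^2\lambda_k+1}U_k$, $\sigma_k^2=\frac{\lambda_k\mathbf 1\{k<n\}}{na_k^2\lambda_k+1}$. Notation: $a\vee b=\max$, $a\wedge b=\min$; $a_n\lesssim b_n$ means $a_n\le Cb_n$ for a constant $C$; $a_n\asymp b_n$ means $a_n/b_n$ is bounded away from $0$ and $\infty$; $a_n\ll b_n$ means $a_n/b_n\to0$.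
   Formalization: In (ii) the conclusion is ε_n ≍ n^{-β/(2β+2p+1)} instead of equality, which fails e.g. for ρ_n = 2n^{(α-β)/(2β+2p+1)}; also Af(x)=Σ a_k f_k ψ_k(x) is assumed pointwise on [0,1] for f in S^β (it follows from continuity of Af by the closed graph theorem). *)

(* Defs.v *)
From HB Require Import structures.
From mathcomp Require Import all_boot all_order all_algebra.
From mathcomp Require Import all_classical all_reals all_analysis.
Set Implicit Arguments.
Unset Strict Implicit.
Unset Printing Implicit Defensive.
Import Order.TTheory GRing.Theory Num.Theory.
Import numFieldNormedType.Exports.
Local Open Scope classical_set_scope.
Local Open Scope ring_scope.

Section defs.
Context {R : realType}.

(* Indexing convention: sequences are functions nat -> R, the paper's index k
   is the natural number k itself (k >= 1); the value at index 0 is never used. *)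

Definition design (n i : nat) : R := i%:R / n%:R.

Definition dinner (n : nat) (g h : R -> R) : R :=
  n%:R^-1 * \sum_(1 <= i < n.+1) g (design n i) * h (design n i).

Definition conj_basis_assumption (psi : nat -> R -> R) (M : R) : Prop :=
  (forall n j k, (2 <= n)%N -> (1 <= j < n)%N -> (1 <= k < n)%N ->
     dinner n (psi j) (psi k) = (j == k)%:R) /\
  (forall n k, (2 <= n)%N -> (1 <= k < n)%N ->
     exists kbar : bool -> nat, (forall b, (kbar b < n)%N) /\
     forall l, (1 <= l)%N ->
       0 < `|dinner n (psi (l * n + kbar (odd l))%N) (psi k)| < M /\
       forall j, (l * n <= j < l.+1 * n)%N -> j != (l * n + kbar (odd l))%N ->
         dinner n (psi j) (psi k) = 0).

Definition asymp_seq (u v : nat -> R) : Prop :=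
  exists c1 c2 : R, 0 < c1 /\ 0 < c2 /\
    \forall k \near \oo, c1 * v k <= u k /\ u k <= c2 * v k.

Definition Sbeta_partial (beta : R) (f : nat -> R) (N : nat) : R :=
  \sum_(1 <= k < N) f k ^+ 2 * (k%:R `^ (2 * beta)).
Definition in_Sbeta (beta : R) (f : nat -> R) : Prop :=
  cvgn (Sbeta_partial beta f).
Definition Sbeta_norm (beta : R) (f : nat -> R) : R :=
  Num.sqrt (limn (Sbeta_partial beta f)).
Definition Sbeta_ball (beta K : R) : set (nat -> R) :=
  [set f | in_Sbeta beta f /\ Sbeta_norm beta f <= K].

(** H_1 distance via coefficients: ||f - g||_{H1} *)
Definition H1dist (f g : nat -> R) : R :=
  Num.sqrt (limn (fun N => \sum_(1 <= k < N) (f k - g k) ^+ 2)).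

Definition iid_std_normal d (T : measurableType d) (P : probability T R)
    (X : nat -> T -> R) : Prop :=
  (forall i, measurable_fun setT (X i)) /\
  forall (s : seq nat) (B : nat -> set R), uniq s ->
    (forall i, measurable (B i)) ->
    P [set w | forall i, i \in s -> B i (X i w)] =
      (\prod_(i <- s) normal_prob 0 1 (B i))%E.

Definition obsY (Af0 : R -> R) d (T : measurableType d) (xi : nat -> T -> R)
    (n : nat) (w : T) (i : nat) : R :=
  Af0 (design n i) + xi i w.

Definition dataU (psi : nat -> R -> R) (Af0 : R -> R) d (T : measurableType d)
    (xi : nat -> T -> R) (n : nat) (w : T) (k : nat) : R :=
  n%:R^-1 * \sum_(1 <= i < n.+1) obsY Af0 xi n w i * psi k (design n i).

Definition lambda (rho : nat -> R) (alpha : R) (n k : nat) : R :=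
  rho n ^+ 2 * (k%:R `^ (-1 - 2 * alpha)).

Definition post_mean (a : nat -> R) (rho : nat -> R) (alpha : R) (n k : nat)
    (u : nat -> R) : R :=
  if (k < n)%N then
    n%:R * a k * lambda rho alpha n k / (n%:R * a k ^+ 2 * lambda rho alpha n k + 1) * u k
  else 0.
Definition post_sd (a : nat -> R) (rho : nat -> R) (alpha : R) (n k : nat) : R :=
  if (k < n)%N then
    Num.sqrt (lambda rho alpha n k / (n%:R * a k ^+ 2 * lambda rho alpha n k + 1))
  else 0.

(** A draw from the posterior  (x) N(hat f_k, sigma_k^2), realised through an
    i.i.d. N(0,1) sequence Z on a probability space Q. *)
Definition post_draw (a rho : nat -> R) (alpha : R) (n : nat) (u : nat -> R)
    d (T : measurableType d) (Z : nat -> T -> R) (w : T) (k : nat) : R :=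
  post_mean a rho alpha n k u + post_sd a rho alpha n k * Z k w.

Definition post_prob (a rho : nat -> R) (alpha : R) (n : nat) (u : nat -> R)
    d (T : measurableType d) (Q : probability T R) (Z : nat -> T -> R)
    (f0 : nat -> R) (r : R) : \bar R :=
  Q [set w | r <= H1dist (post_draw a rho alpha n u Z w) f0].

Definition exp_post_prob (a rho : nat -> R) (alpha : R) (psi : nat -> R -> R)
    (Af0 : R -> R) d1 (T1 : measurableType d1) (P : probability T1 R)
    (xi : nat -> T1 -> R) d2 (T2 : measurableType d2) (Q : probability T2 R)
    (Z : nat -> T2 -> R) (n : nat) (f0 : nat -> R) (r : R) : \bar R :=
  (\int[P]_w post_prob a rho alpha n (dataU psi Af0 xi n w) Q Z f0 r)%E.

Definition eps_rate (alpha beta p : R) (rho : nat -> R) (n : nat) : R :=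
  Num.max ((rho n ^+ 2 * n%:R) `^ (- Num.min (beta / (2 * alpha + 2 * p + 1)) 1))
          (rho n * (rho n ^+ 2 * n%:R) `^ (- (alpha / (2 * alpha + 2 * p + 1)))).

End defs.

(* Main.v *)
Require Import Defs.
From HB Require Import structures.
From mathcomp Require Import all_boot all_order all_algebra.
From mathcomp Require Import all_classical all_reals all_analysis.
From mathcomp Require Import measurable_realfun ring lra.
Set Implicit Arguments.
Unset Strict Implicit.
Unset Printing Implicit Defensive.
Import Order.TTheory GRing.Theory Num.Theory.
Import numFieldNormedType.Exports.
Local Open Scope classical_set_scope.
Local Open Scope ring_scope.

(** Split a posterior draw minus the truth, coefficient by coefficient, into
    shrinkage bias, aliasing error, noise and posterior fluctuation, and apply
    Markov's inequality to the squared distance.  With S = rho_n^2 n and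
    q = 2 alpha + 2 p + 1, the posterior variance has total mass of order
    rho_n^2 S^(-2 alpha / q).  This mass also controls the noise, and, by
    Cauchy-Schwarz and 2 beta + 2 p > 1, the aliasing, whose squared size is
    O(1/n) per coefficient.  The squared shrinkage bias is of order
    S^(-2 min(beta / q, 1)), and the truncated tail n^(-beta) is dominated by
    eps_n whether S <= n^q or S > n^q. *)

(** * Second moments of independent standard normal variables *)

(** The risk bound is nonasymptotic: for [n >= 2] and [S >= 1] its constant is chosen before [rho],
    [n] and [f], so uniformity over the ball is built in, and Markov's inequality at radius
    [M_n eps_n] leaves [C / M_n^2]. One sum serves noise, aliasing and posterior spread because,
    with [w_k = n a_k^2 lambda_k] and [t_k] the factor of [U_k] in the posterior mean, [t_k^2 / n =
    sigma_k^2 w_k / (w_k + 1) <= sigma_k^2]. An obstacle is measurability: the posterior probability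
    is never shown to be a measurable function of the data, so the outer integral is bounded by
    monotonicity alone. *)

Section monotone.
Context {d} {T : measurableType d} {R : realType} (mu : {measure set T -> \bar R}).
Import HBNNSimple.
Local Open Scope ereal_scope.

(** The integral of a nonnegative function is a supremum over the simple functions below it, so
    monotonicity asks for no measurability. *)
Lemma ge0_le_integral_nomeas (f g : T -> \bar R) :
  (forall x, 0 <= f x) -> (forall x, f x <= g x) ->
  \int[mu]_x f x <= \int[mu]_x g x.
Proof.
move=> f0 fg; have g0 x : 0 <= g x by exact: le_trans (f0 x) (fg x).
rewrite !ge0_integralTE//; apply: le_ereal_sup => _ [h hf <-].
by exists h => // x; exact: le_trans (hf x) (fg x).
Qed.
End monotone.

Section normal.
Context {R : realType}.
Local Notation N := (normal_prob (0 : R) 1).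
Local Notation mu := (@lebesgue_measure R).
Local Notation phi := (normal_pdf (0 : R) 1).

(** The Radon-Nikodym derivative of the normal law and the explicit density have the same integral
    over every measurable set, hence agree almost everywhere. *)
Lemma ge0_integral_normal_prob (f : R -> \bar R) :
  (forall x, 0 <= f x)%E -> measurable_fun setT f ->
  (\int[N]_x f x = \int[mu]_x (f x * (phi x)%:E))%E.
Proof.
move=> f0 mf.
have dom := normal_prob_dominates (0 : R) 1.
rewrite -(Radon_Nikodym_SigmaFinite.change_of_variables dom)//.
have mphi : measurable_fun setT (fun x => (phi x)%:E).
  by apply/measurable_EFinP; exact: measurable_normal_pdf.
have iRN := Radon_Nikodym_SigmaFinite.f_integrable dom.
apply: ae_eq_integral => //.
- by apply: emeasurable_funM => //; exact: measurable_int iRN.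
- exact: emeasurable_funM.
apply: ae_eqe_mul2l; apply: integral_ae_eq => //.
by move=> E _ mE; rewrite -Radon_Nikodym_SigmaFinite.f_integral.
Qed.

Lemma normal_pdf01E (x : R) : phi x = normal_peak 1 * expR (- (x ^+ 2 / 2)).
Proof. by rewrite normal_pdfE ?oner_eq0// /normal_fun subr0 expr1n mulNr. Qed.

Lemma normal_pdf01N (x : R) : phi (- x) = phi x.
Proof. by rewrite !normal_pdf01E sqrrN. Qed.

Let gauss_moment (u p : R) : 0 < p ->
  4 * u * (p * expR (- u - u)) <= 4 * p * expR (- u).
Proof.
move=> p0; have -> : 4 * u * (p * expR (- u - u)) = 4 * p * (u * expR (- u - u)).
  by rewrite -!mulrA; congr (_ * _); rewrite mulrCA.
rewrite ler_pM2l ?mulr_gt0// expRD mulrA ler_piMl ?expR_ge0//.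
rewrite expRN ler_pdivrMr ?expR_gt0// mul1r.
by apply: le_trans (expR_ge1Dx u); rewrite lerDr.
Qed.

(* x^2 exp(-x^2/2) <= 4 exp(-x^2/4), and the right-hand side is a multiple of the N(0,2) density. *)
Lemma normal_second_moment_lty : (\int[N]_x (x ^+ 2)%:E < +oo)%E.
Proof.
rewrite ge0_integral_normal_prob; last 2 first.
- by move=> x; rewrite lee_fin sqr_ge0.
- by apply/measurable_EFinP; exact: measurable_funX.
pose s : R := Num.sqrt 2.
have s0 : s != 0 by rewrite gt_eqF// sqrtr_gt0.
have s2 : s ^+ 2 = 2 by rewrite sqr_sqrtr.
pose c : R := 4 * normal_peak 1 / normal_peak s.
apply: (@le_lt_trans _ _ (\int[mu]_x (c%:E * (normal_pdf 0 s x)%:E))%E).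
  apply: ge0_le_integral_nomeas => x; rewrite -EFinM lee_fin.
    by rewrite mulr_ge0 ?sqr_ge0 ?normal_pdf_ge0.
  have p0 : 0 < normal_peak 1 :> R by rewrite normal_peak_gt0// oner_neq0.
  have ps := normal_peak_gt0 s0.
  rewrite normal_pdf01E [normal_pdf 0 s]normal_pdfE// /normal_fun s2 subr0 /c.
  set u := x ^+ 2 / 4.
  have -> : - (x ^+ 2 / 2) = - u - u by rewrite /u; lra.
  have -> : - x ^+ 2 / (2 *+ 2) = - u by rewrite /u -mulrnA mulNr.
  have -> : x ^+ 2 = 4 * u by rewrite /u; lra.
  by rewrite [leRHS]mulrA divfK ?gt_eqF//; exact: gauss_moment.
rewrite integralZl//; last exact: integrable_normal_pdf.
by rewrite integral_normal_pdf mule1 ltry.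
Qed.

Lemma normal_integrable_sqr : N.-integrable setT (fun x : R => (x ^+ 2)%:E).
Proof.
apply/integrableP; split; first by apply/measurable_EFinP; exact: measurable_funX.
under eq_integral do rewrite gee0_abs ?lee_fin ?sqr_ge0//.
exact: normal_second_moment_lty.
Qed.

Lemma normal_integrable_id : N.-integrable setT (fun x : R => x%:E).
Proof.
have i1 : N.-integrable setT (fun x : R => (1 + x ^+ 2)%:E).
  under eq_fun do rewrite EFinD.
  apply: integrableD => //; last exact: normal_integrable_sqr.
  exact: finite_measure_integrable_cst.
apply: le_integrable i1 => //; first exact/measurable_EFinP.
move=> x _; rewrite lee_fin (ger0_norm (_ : 0 <= 1 + x ^+ 2)) ?addr_ge0 ?sqr_ge0//.
rewrite -(real_normK (num_real x)); have := sqr_ge0 (`|x| - 1); nra.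
Qed.

(** The reflection [x -> - x], which preserves the density, carries the negative part onto the
    positive part. *)
Lemma normal_mean0 : (\int[N]_x x%:E = 0)%E.
Proof.
have cphi : continuous phi by exact: continuous_normal_pdf (oner_neq0 R).
have mphi := measurable_normal_pdf (0 : R) 1.
rewrite integralE.
suff -> : (\int[N]_x (fun z : R => z%:E)^\- x = \int[N]_x (fun z : R => z%:E)^\+ x)%E.
  rewrite subee// integrable_fin_num//.
  exact: integrable_funepos normal_integrable_id.
rewrite !ge0_integral_normal_prob//; last 2 first.
- by apply: measurable_funepos; exact/measurable_EFinP.
- by apply: measurable_funeneg; exact/measurable_EFinP.
pose g (x : R) := Num.max x 0 * phi x.
have cg : continuous g.
  move=> x; apply: cvgM; last exact: cphi.
  by apply: continuous_max => //; exact: cvg_cst.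
have g0 x : 0 <= g x by rewrite mulr_ge0 ?normal_pdf_ge0// le_max lexx orbT.
have -> : (\int[mu]_x ((fun z : R => z%:E)^\+ x * (phi x)%:E) = \int[mu]_x (g x)%:E)%E.
  by apply: eq_integral => x _; rewrite funeposE -EFin_max -EFinM.
have -> : (\int[mu]_x ((fun z : R => z%:E)^\- x * (phi x)%:E) =
           \int[mu]_x (g (- x))%:E)%E.
  by apply: eq_integral => x _; rewrite funenegE -EFinN -EFin_max -EFinM /g normal_pdf01N.
have gN x : x <= 0 -> g x = 0 by move=> x0; rewrite /g max_r// mul0r.
(* [g] vanishes on nonpositive reals, so only a half-line matters; its endpoint is written [- 0] to
   fit the substitution rule. *)
have -> : (\int[mu]_x (g (- x))%:E = \int[mu]_(x in `]-oo, (- 0)%R]) (g (- x))%:E)%E.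
  rewrite [RHS]integral_mkcond; apply: eq_integral => x _; rewrite patchE.
  case: ifPn => //; rewrite notin_setE/= in_itv/= oppr0 => /negP; rewrite -ltNge => x0.
  by rewrite gN// oppr_le0 ltW.
rewrite ge0_integration_by_substitutionNy//; last first.
  apply: continuous_subspaceT => x.
  by apply: (@continuous_comp _ _ _ -%R g); [exact: opp_continuous|exact: cg].
have -> : (\int[mu]_x (g x)%:E = \int[mu]_(x in `[0%R, +oo[) (((fun x => g (- x)) \o -%R) x)%:E)%E.
  rewrite [RHS]integral_mkcond; apply: eq_integral => x _; rewrite patchE/= opprK.
  case: ifPn => //; rewrite notin_setE/= in_itv/= andbT => /negP; rewrite -ltNge => x0.
  by rewrite gN// ltW.
by [].
Qed.
End normal.

(** * Transfer of integrals to the law of a random variable *)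

Section law.
Local Open Scope ereal_scope.
Context {d d'} {T : measurableType d} {T' : measurableType d'} {R : realType}.
Context (P : probability T R) (N : {measure set T' -> \bar R}) (Y : {mfun T >-> T'}).
Context (law : forall A, measurable A -> P (Y @^-1` A) = N A).

Let integral_law0 (g : T' -> \bar R) :
  \int[distribution P Y]_x g x = \int[N]_x g x.
Proof. by apply: eq_measure_integral => A mA _; exact: law. Qed.

Lemma integrable_law (g : T' -> \bar R) : measurable_fun setT g ->
  P.-integrable setT (g \o Y) <-> N.-integrable setT g.
Proof.
move=> mg; have E : \int[P]_x `|(g \o Y) x| = \int[N]_x `|g x|.
  rewrite -integral_law0 ge0_integral_distribution//.
  exact: measurableT_comp.
split=> /integrableP[_ oo]; apply/integrableP; split => //.
- by rewrite -E.
- exact: measurableT_comp.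
- by rewrite E.
Qed.

(** The target space is arbitrary so that this serves a single variable as well as a pair with its
    product law. *)
Lemma integral_law (g : T' -> \bar R) : measurable_fun setT g ->
  N.-integrable setT g -> \int[P]_w g (Y w) = \int[N]_x g x.
Proof.
move=> mg ig; rewrite -integral_law0 integral_distribution//.
exact/integrable_law.
Qed.
End law.

(** * Moments and covariances of the i.i.d. sequence *)

Section iid.
Context {R : realType} {d} {T : measurableType d} (P : probability T R).
Context (X : nat -> T -> R) (iidX : iid_std_normal P X).
Local Notation N := (normal_prob (0 : R) 1).
Local Notation V := (\int[N]_x (x ^+ 2)%:E)%E.

Let mX i : measurable_fun setT (X i) := iidX.1 i.

Lemma iid_std_normal_law i (A : set R) : measurable A -> P (X i @^-1` A) = N A.
Proof.
move=> mA; have := iidX.2 [:: i] (fun=> A) isT (fun=> mA).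
rewrite big_seq1 => <-; congr (P _); apply/seteqP; split => w /=.
  by move=> Aw j; rewrite inE => /eqP ->.
by apply; rewrite inE.
Qed.

Lemma iid_std_normal_pair i j (A B : set R) : i != j ->
  measurable A -> measurable B ->
  P (X i @^-1` A `&` X j @^-1` B) = (N A * N B)%E.
Proof.
move=> ij mA mB.
have := iidX.2 [:: i; j] (fun k => if k == i then A else B).
rewrite /= inE ij => /(_ isT) H; rewrite big_cons big_seq1 eqxx eq_sym (negbTE ij) in H.
rewrite -H; last by move=> k; case: ifP.
congr (P _); apply/seteqP; split => w /=.
  move=> [Aw Bw] k; rewrite !inE => /orP[/eqP ->|/eqP ->]; first by rewrite eqxx.
  by rewrite eq_sym (negbTE ij).
move=> h; split; first by have := h i; rewrite !inE eqxx; exact.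
by have := h j; rewrite !inE eqxx orbT eq_sym (negbTE ij); exact.
Qed.

Let Xr i : T -> measurableTypeR R := X i.

Let mXr i : measurable_fun setT (Xr i).
Proof. exact: mX. Qed.

HB.instance Definition _ i := isMeasurableFun.Build _ _ _ _ (Xr i) (mXr i).

Lemma iid_second_moment i : (\int[P]_w (X i w ^+ 2)%:E = V)%E.
Proof.
apply: (@integral_law _ _ _ _ _ P N (Xr i) _ (fun x => (x ^+ 2)%:E)).
- exact: iid_std_normal_law.
- by apply/measurable_EFinP; exact: measurable_funX.
- exact: normal_integrable_sqr.
Qed.

(** Domination by [X_i^2 + X_j^2] works without independence and for [i = j]; it also yields the
    integrability under the product law that Fubini requires. *)
Lemma integrable_iid_mul i j : P.-integrable setT (fun w => (X i w * X j w)%:E).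
Proof.
have isq k : P.-integrable setT (fun w => (X k w ^+ 2)%:E).
  apply/(@integrable_law _ _ _ _ _ P N (Xr k) _ (fun x => (x ^+ 2)%:E)).
  - exact: iid_std_normal_law.
  - by apply/measurable_EFinP; exact: measurable_funX.
  - exact: normal_integrable_sqr.
have : P.-integrable setT (fun w => (X i w ^+ 2)%:E + (X j w ^+ 2)%:E)%E.
  by exact: integrableD.
apply: le_integrable => //; first by apply/measurable_EFinP; exact: measurable_funM.
move=> w _; rewrite -EFinD lee_fin [leRHS]ger0_norm ?addr_ge0 ?sqr_ge0//.
rewrite ler_norml; have := sqr_ge0 (X i w - X j w); have := sqr_ge0 (X i w + X j w); nra.
Qed.

(** The law of the pair agrees with the product measure on rectangles, hence everywhere; Fubini and
    the zero mean conclude. *)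
Lemma iid_uncorrelated i j : i != j -> (\int[P]_w (X i w * X j w)%:E = 0)%E.
Proof.
move=> ij.
pose XX w := (Xr i w, Xr j w).
have mXX : measurable_fun setT XX by exact: measurable_fun_pair.
pose XXm := isMeasurableFun.Build _ _ _ _ _ mXX.
pose XXp : {mfun T >-> (measurableTypeR R * measurableTypeR R)%type} := HB.pack XX XXm.
pose h (z : measurableTypeR R * measurableTypeR R) := ((z.1 : R) * (z.2 : R))%:E.
have mh : measurable_fun setT h.
  by apply/measurable_EFinP; apply: measurable_funM.
have lawE A : measurable A -> P (XXp @^-1` A) = (N \x N)%E A.
  move=> mA; apply/esym.
  apply: (@product_measure_unique _ _ _ _ _ N N (distribution P XXp)) => // A1 B1 mA1 mB1.
  by rewrite -(iid_std_normal_pair ij).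
have ihN : ((N \x N)%E).-integrable setT h.
  by apply/(integrable_law lawE mh); exact: integrable_iid_mul.
rewrite -[LHS]/(\int[P]_w (h (XXp w)))%E (integral_law lawE)//.
rewrite -integral12_prod_meas1//; apply: integral0_eq => x _.
rewrite /fubini_F /h /=; under eq_integral do rewrite EFinM.
by rewrite integralZl ?normal_mean0 ?mule0//; exact: normal_integrable_id.
Qed.

(** Only the diagonal of the expanded square survives; [uniq s] makes each index meet itself exactly
    once. *)
Lemma iid_linear_second_moment (s : seq nat) (c : nat -> R) : uniq s ->
  (\int[P]_w ((\sum_(i <- s) X i w * c i) ^+ 2)%:E = (\sum_(i <- s) c i ^+ 2)%:E * V)%E.
Proof.
move=> us.
have E w : ((\sum_(i <- s) X i w * c i) ^+ 2)%:E =
    (\sum_(i <- s) \sum_(j <- s) (c i * c j)%:E * (X i w * X j w)%:E)%E.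
  rewrite expr2 mulr_suml -sumEFin; apply: eq_bigr => i _.
  rewrite mulr_sumr -sumEFin; apply: eq_bigr => j _.
  by rewrite -EFinM; congr EFin; ring.
under eq_integral do rewrite E.
have iij i j : P.-integrable setT (fun w => (c i * c j)%:E * (X i w * X j w)%:E)%E.
  by apply: integrableZl => //; exact: integrable_iid_mul.
rewrite integral_sum//; last by move=> i; apply: integrable_sum.
rewrite -sumEFin ge0_sume_distrl; last by move=> i _; rewrite lee_fin sqr_ge0.
rewrite [LHS]big_seq [RHS]big_seq; apply: eq_bigr => i si.
rewrite integral_sum// (bigD1_seq i)//= big1 => [|j ji].
  rewrite adde0 integralZl//; last exact: integrable_iid_mul.
  by rewrite -(iid_second_moment i).
rewrite integralZl//; last exact: integrable_iid_mul.
by rewrite iid_uncorrelated ?mule0// eq_sym.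
Qed.
End iid.

(** * Sums of powers *)

Section powR_sums.
Context {R : realType}.
Implicit Types (s q c x y S : R) (k m n N : nat).

Lemma powR_le_neg x y s : 0 < x -> x <= y -> 0 <= s -> y `^ (- s) <= x `^ (- s).
Proof.
move=> x0 xy s0; have y0 := lt_le_trans x0 xy.
rewrite !powRN lef_pV2 ?posrE ?powR_gt0//.
by rewrite ge0_ler_powR// ?nnegrE ltW.
Qed.

(** Discrete form of the derivative of [- x^(-s)]: with [x = k + 1], [k = x (1 - 1/x)] and
    [(1 - 1/x)^(-s) >= exp(s/x) >= 1 + s/x]. *)
Lemma powR_telescope s k : 0 < s -> (0 < k)%N ->
  s * k.+1%:R `^ (-1 - s) <= k%:R `^ (- s) - k.+1%:R `^ (- s).
Proof.
move=> s0 k0; set x : R := k.+1%:R; have x0 : 0 < x by rewrite ltr0n.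
have y0 : 0 < k%:R :> R by rewrite ltr0n.
have yE : k%:R = x * (1 + - x^-1).
  by rewrite mulrDr mulrN divff ?gt_eqF// mulr1 /x -natr1 addrK.
have z0 : 0 < 1 + - x^-1 by rewrite -(pmulr_rgt0 _ x0) -yE.
rewrite yE powRM ?(ltW x0) ?(ltW z0)//.
have : expR (s * x^-1) <= (1 + - x^-1) `^ (- s).
  rewrite /powR gt_eqF// ler_expR mulNr -mulrN ler_pM2l// lerNr.
  by apply: le_ln1Dx; rewrite -subr_gt0 opprK addrC.
move=> /(le_trans (expR_ge1Dx _)) h.
have -> : s * x `^ (-1 - s) = x `^ (- s) * (s * x^-1).
  rewrite powRD; last by rewrite (gt_eqF x0) implybT.
  by rewrite powR_inv1 ?(ltW x0)//; ring.
rewrite -subr_ge0 -[X in 0 <= _ - X - _]mulr1 -!mulrBr.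
by rewrite mulr_ge0 ?powR_ge0// -addrA -opprD subr_ge0.
Qed.

Lemma sum_powR_tail s m N : 0 < s -> (0 < m)%N ->
  \sum_(m.+1 <= k < N) k%:R `^ (-1 - s) <= m%:R `^ (- s) / s.
Proof.
move=> s0 m0; rewrite ler_pdivlMr// mulrC.
have [Nm|mN] := leqP N m.+1; first by rewrite big_geq// mulr0 powR_ge0.
(* The subtracted remainder is kept so that each new term is absorbed by [powR_telescope]. *)
suff H d : s * \sum_(m.+1 <= k < m.+1 + d) k%:R `^ (-1 - s) <=
    m%:R `^ (- s) - (m + d)%:R `^ (- s).
  rewrite -(subnKC (ltnW mN)); apply: le_trans (H _) _.
  by rewrite lerBlDr lerDl powR_ge0.
elim: d => [|d IH]; first by rewrite addn0 big_geq// mulr0 addn0 subrr.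
rewrite addnS big_nat_recr ?leq_addr//= mulrDr.
have md : (0 < m + d)%N by rewrite addn_gt0 m0.
have := powR_telescope s0 md; rewrite -addSn addnS; lra.
Qed.

Lemma sum_powR_le s N : 0 < s ->
  \sum_(1 <= k < N) k%:R `^ (-1 - s) <= 1 + s^-1.
Proof.
move=> s0; case: N => [|[|N]].
- by rewrite big_geq// addr_ge0// invr_ge0 ltW.
- by rewrite big_geq// addr_ge0// invr_ge0 ltW.
rewrite big_ltn// powR1 lerD2l; apply: le_trans (sum_powR_tail _ s0 _) _ => //.
by rewrite powR1 mul1r.
Qed.

(* Split at k = S^{1/q}, where the two regimes of the denominator meet. *)
Lemma sum_spread_le s q c : 0 < s -> s + 1 <= q -> 0 < c ->
  exists2 C, 0 < C & forall S N, 1 <= S ->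
    \sum_(1 <= k < N) k%:R `^ (-1 - s) / (c * (S * k%:R `^ (- q)) + 1)
    <= C * S `^ (- (s / q)).
Proof.
move=> s0 sq c0; exists (c^-1 + 2 `^ s / s).
  by rewrite addr_gt0 ?invr_gt0// divr_gt0// powR_gt0.
move=> S N S1; have S0 : 0 < S by lra.
have q0 : 0 < q by lra.
pose J := S `^ q^-1; have J0 : 0 < J by rewrite powR_gt0.
have J1 : 1 <= J by rewrite -[leLHS](powRr0 S) ler_powR// invr_ge0 ltW.
have JE : J `^ q = S by rewrite -powRrM mulVf ?gt_eqF// powRr1// ltW.
have JsE : J `^ (- s) = S `^ (- (s / q)).
  by rewrite -powRrM; congr (_ `^ _); rewrite mulrN mulrC.
pose F k := k%:R `^ (-1 - s) / (c * (S * k%:R `^ (- q)) + 1) : R.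
have D0 k : 0 < c * (S * k%:R `^ (- q)) + 1.
  by rewrite ltr_wpDl// !mulr_ge0 ?powR_ge0// ltW.
have F0 k : 0 <= F k by rewrite divr_ge0 ?powR_ge0// ltW.
pose m := Num.truncn J.
have /andP[mJ Jm] : m%:R <= J < m.+1%:R by apply: truncn_itv; exact: ltW.
have m0 : (0 < m)%N by rewrite truncn_gt0.
have m0R : 0 < m%:R :> R by rewrite ltr0n.
(* The range is enlarged so that it can be cut at [m + 1] whatever [N] is. *)
apply: (@le_trans _ _ (\sum_(1 <= k < m.+1 + N) F k)).
  have [N0|N0] := posnP N; first by rewrite N0 big_geq// sumr_ge0.
  rewrite [leRHS](@big_cat_nat _ _ _ N)//= ?leq_addl//.
  by rewrite lerDl; apply: sumr_ge0 => k _; exact: F0.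
rewrite (@big_cat_nat _ _ _ m.+1)//= ?leq_addr// mulrDl lerD//.
(* Below the cut, dropping [+ 1] leaves a multiple of [k^(q - 1 - s)], nondecreasing since
   [s + 1 <= q]; each of the [m <= J] terms is thus at most its value at [J]. *)
- apply: (@le_trans _ _ (\sum_(1 <= k < m.+1) J `^ (-1 - s) / c)).
    apply: ler_sum_nat => k /andP[k1 km].
    have k0 : 0 < k%:R :> R by rewrite ltr0n.
    have kJ : k%:R <= J by apply: le_trans mJ; rewrite ler_nat.
    have kq0 : 0 < k%:R `^ (- q) :> R by rewrite powR_gt0.
    apply: (@le_trans _ _ (k%:R `^ (-1 - s) / (c * (S * k%:R `^ (- q))))).
      by rewrite ler_pM2l ?powR_gt0// lef_pV2 ?posrE ?lerDl// !mulr_gt0.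
    have -> : k%:R `^ (-1 - s) / (c * (S * k%:R `^ (- q))) =
        k%:R `^ (q - (1 + s)) / S / c :> R.
      rewrite [in RHS]powRD ?(gt_eqF k0) ?implybT// !invfM -powRN opprK.
      by rewrite opprD; ring.
    have -> : J `^ (-1 - s) = J `^ (q - (1 + s)) / S.
      rewrite [in RHS]powRD ?(gt_eqF J0) ?implybT// JE opprD.
      by rewrite mulrAC mulfV ?gt_eqF// mul1r.
    by rewrite !ler_pM2r ?invr_gt0// ge0_ler_powR ?nnegrE; lra.
  rewrite sumr_const_nat subn1/= -mulr_natl -JsE.
  rewrite [leRHS]mulrC mulrA ler_pM2r ?invr_gt0//.
  have -> : J `^ (- s) = J * J `^ (-1 - s).
    by rewrite [in RHS]powRD ?(gt_eqF J0) ?implybT// powR_inv1 ?(ltW J0)// mulrA mulfV ?gt_eqF// mul1r.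
  by rewrite ler_wpM2r// powR_ge0.
(* Above the cut the denominator is at least 1. As [J < m + 1 <= 2 m], replacing [m] by [J / 2]
   costs the factor [2^s]. *)
apply: (@le_trans _ _ (\sum_(m.+1 <= k < m.+1 + N) k%:R `^ (-1 - s))).
  apply: ler_sum => k _; rewrite ler_pdivrMr// ler_peMr ?powR_ge0//.
  by rewrite lerDr !mulr_ge0 ?powR_ge0// ltW.
apply: le_trans (sum_powR_tail _ s0 m0) _.
rewrite mulrAC ler_pM2r ?invr_gt0// -JsE.
have -> : 2 `^ s * J `^ (- s) = (J / 2) `^ (- s).
  rewrite powRM ?invr_ge0// ?(ltW J0)// mulrC; congr (_ * _).
  by rewrite -powR_inv1// -powRrM; congr (_ `^ _); ring.
apply: powR_le_neg; rewrite ?(ltW s0)// ?divr_gt0//.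
move: Jm; rewrite -natr1 => Jm; have m1 : 1 <= m%:R :> R by rewrite ler1n.
by rewrite ler_pdivrMr//; lra.
Qed.

(** With [y = S k^(-q)] and [t = min (b/q) 1], [k^(-b) <= k^(-q t) = S^(-t) y^t], and [y^t <= 1 + y]
    because [t <= 1]. The cap at 1 is saturation: for fixed [k] the shrinkage factor decays no
    faster than [1 / S]. *)
Lemma bias_weight_le b q c : 0 < b -> 0 < q -> 0 < c ->
  forall S k, 1 <= S -> (0 < k)%N ->
    k%:R `^ (- b) / (c * (S * k%:R `^ (- q)) + 1) <=
    (1 + c^-1) * S `^ (- Num.min (b / q) 1).
Proof.
move=> b0 q0 c0 S k S1 k0; set t := Num.min _ _.
have S0 : 0 < S by lra.
have t0 : 0 < t by rewrite lt_min divr_gt0//=.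
have tb : q * t <= b by rewrite mulrC -ler_pdivlMr// ge_min lexx.
have t1 : t <= 1 by rewrite ge_min lexx orbT.
have k0R : 0 < k%:R :> R by rewrite ltr0n.
have k1R : 1 <= k%:R :> R by rewrite ler1n.
pose y := S * k%:R `^ (- q); have y0 : 0 < y by rewrite mulr_gt0// powR_gt0.
have kE : k%:R `^ (- b) <= S `^ (- t) * y `^ t.
  rewrite powRM ?powR_ge0 ?(ltW S0)// mulrA -powRD; last by rewrite (gt_eqF S0) implybT.
  by rewrite addNr powRr0 mul1r -powRrM ler_powR// mulNr lerN2.
have yt : y `^ t <= 1 + y.
  have [y1|y1] := leP y 1.
    apply: (@le_trans _ _ (1 `^ t)); last by rewrite powR1 lerDl ltW.
    by rewrite ge0_ler_powR// ?nnegrE// ltW.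
  apply: (@le_trans _ _ (y `^ 1)); first by rewrite ler_powR// ltW.
  by rewrite powRr1 ?(ltW y0)// lerDr.
rewrite -/y ler_pdivrMr; last by rewrite ltr_wpDl// mulr_ge0// ltW.
apply: le_trans kE _; rewrite [leRHS]mulrAC [leRHS]mulrC ler_pM2l ?powR_gt0//.
apply: le_trans yt _; rewrite mulrDl mul1r [c^-1 * _]mulrDr mulKf ?gt_eqF//.
have : 0 < c^-1 by rewrite invr_gt0.
have := mulr_gt0 c0 y0; lra.
Qed.

End powR_sums.

(** * Sequence space and aliasing *)

Section sequence_space.
Context {R : realType}.
Implicit Types (beta p K M s : R) (f a : nat -> R) (psi : nat -> R -> R).

(** Summing [2 u v <= (B/A) u^2 + (A/B) v^2] turns bounds on the two square sums directly into the
    product bound, without square roots of sums. *)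
Lemma sum_cauchy_schwarz (A B : R) (I : Type) (r : seq I) (x y : I -> R) :
  0 < A -> 0 < B -> \sum_(i <- r) x i ^+ 2 <= A ^+ 2 -> \sum_(i <- r) y i ^+ 2 <= B ^+ 2 ->
  `|\sum_(i <- r) x i * y i| <= A * B.
Proof.
move=> A0 B0 hx hy; apply: le_trans (ler_norm_sum _ _ _) _.
apply: (@le_trans _ _ (\sum_(i <- r) (B / A / 2 * x i ^+ 2 + A / B / 2 * y i ^+ 2))).
  apply: ler_sum => i _; rewrite normrM -(real_normK (num_real (x i))).
  rewrite -(real_normK (num_real (y i))).
  set u := `|x i|; set v := `|y i|.
  have -> : u * v = (u / A) * (v / B) * (A * B) by field; rewrite !gt_eqF.
  have -> : B / A / 2 * u ^+ 2 + A / B / 2 * v ^+ 2 =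
    ((u / A) ^+ 2 + (v / B) ^+ 2) / 2 * (A * B) by field; rewrite !gt_eqF.
  rewrite ler_pM2r ?mulr_gt0//; have := sqr_ge0 (u / A - v / B); nra.
rewrite big_split/= -!mulr_sumr.
have -> : A * B = B / A / 2 * A ^+ 2 + A / B / 2 * B ^+ 2 by field; rewrite !gt_eqF.
by rewrite lerD// ler_wpM2l// !mulr_ge0 ?invr_ge0 ?ltW.
Qed.

Lemma Sbeta_partial_nd beta f : nondecreasing_seq (Sbeta_partial beta f).
Proof.
apply/nondecreasing_seqP => -[|n]; rewrite /Sbeta_partial; first by rewrite !big_geq.
by rewrite [leRHS]big_nat_recr//= lerDl mulr_ge0 ?sqr_ge0 ?powR_ge0.
Qed.

Lemma Sbeta_partial_le beta K f N : 0 < K -> Sbeta_ball beta K f ->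
  Sbeta_partial beta f N <= K ^+ 2.
Proof.
move=> K0 [cf nf].
apply: le_trans (nondecreasing_cvgn_le (@Sbeta_partial_nd beta f) cf N) _.
have l0 : 0 <= limn (Sbeta_partial beta f).
  by apply: limr_ge => //; apply: nearW => n; apply: sumr_ge0 => k _;
    rewrite mulr_ge0 ?sqr_ge0 ?powR_ge0.
by rewrite -(sqr_sqrtr l0) ler_pXn2r ?nnegrE ?sqrtr_ge0// ltW.
Qed.

(** Shows that the ball is nonempty, so that the supremum over it is at least 0. *)
Lemma Sbeta_ball0 beta K : 0 < K -> Sbeta_ball beta K (fun=> 0).
Proof.
move=> K0; have E : Sbeta_partial beta (fun=> 0) = fun=> 0.
  by apply/funext => N; apply: big1 => k _; rewrite expr0n mul0r.
split; first by rewrite /in_Sbeta E; exact: is_cvg_cst.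
by rewrite /Sbeta_norm E lim_cst// sqrtr0 ltW.
Qed.

Lemma Sbeta_tail_le beta K f n N : 0 <= beta -> 0 < K -> (0 < n)%N ->
  Sbeta_ball beta K f ->
  \sum_(n <= k < N) f k ^+ 2 <= (K * n%:R `^ (- beta)) ^+ 2.
Proof.
move=> b0 K0 n0 fK.
have n0R : 0 < n%:R :> R by rewrite ltr0n.
rewrite exprMn -[X in _ * X]powR_mulrn ?powR_ge0// -powRrM mulNr powRN ler_pdivlMr ?powR_gt0//.
have [Nn|nN] := leqP N n; first by rewrite big_geq// mul0r sqr_ge0.
apply: le_trans (Sbeta_partial_le N K0 fK).
rewrite /Sbeta_partial (@big_cat_nat _ _ _ n 1)//= ?(ltnW nN)//.
apply: ler_wpDl.
  by apply: sumr_ge0 => k _; rewrite mulr_ge0 ?sqr_ge0 ?powR_ge0.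
rewrite mulr_suml; apply: ler_sum_nat => k /andP[nk _].
rewrite ler_wpM2l ?sqr_ge0// mulrC ge0_ler_powR ?nnegrE ?ler0n ?mulr_ge0//.
by rewrite ler_nat.
Qed.

Lemma Sbeta_tail_cvg beta K f n : 0 <= beta -> 0 < K -> (0 < n)%N ->
  Sbeta_ball beta K f -> cvgn (fun N => \sum_(n <= k < N) f k ^+ 2).
Proof.
move=> b0 K0 n0 fK; apply: nondecreasing_is_cvgn.
  apply/nondecreasing_seqP => N; have [nN|Nn] := leqP n N.
    by rewrite [leRHS]big_nat_recr//= lerDl sqr_ge0.
  by rewrite !big_geq// ltnW.
by exists ((K * n%:R `^ (- beta)) ^+ 2) => _ [N _ <-]; exact: Sbeta_tail_le.
Qed.

Lemma cvg_mulnr (n : nat) : (0 < n)%N -> (fun l => (l * n)%N) @ \oo --> \oo.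
Proof.
move=> n0; apply/cvgnyPge => N; near=> l.
apply: (@leq_trans l); last by rewrite leq_pmulr.
by near: l; exact: nbhs_infty_ge.
Unshelve. all: by end_near. Qed.

Lemma design_itv (n i : nat) : (0 < n)%N -> (i <= n)%N -> @design R n i \in `[0, 1].
Proof.
move=> n0 ni; rewrite in_itv/= /design divr_ge0//= ler_pdivrMr ?ltr0n// mul1r.
by rewrite ler_nat.
Qed.

(** The discrete inner product is a finite sum over design points of [[0, 1]], so pointwise
    convergence there allows termwise application. *)
Lemma cvg_dinner_series (g : R -> R) (e : nat -> R -> R) (c : nat -> R) h n :
  (0 < n)%N ->
  (forall x, x \in `[0, 1] -> (fun N => \sum_(1 <= k < N) c k * e k x) @ \oo --> g x) ->
  (fun N => \sum_(1 <= j < N) c j * dinner n (e j) h) @ \oo --> dinner n g h.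
Proof.
move=> n0 cg.
have -> : (fun N => \sum_(1 <= j < N) c j * dinner n (e j) h) =
  (fun N => n%:R^-1 * \sum_(1 <= i < n.+1)
     (\sum_(1 <= j < N) c j * e j (design n i)) * h (design n i)).
  apply/funext => N; rewrite /dinner.
  under eq_bigr do rewrite mulrCA mulr_sumr.
  rewrite -mulr_sumr exchange_big/=; congr (_ * _); apply: eq_bigr => i _.
  by rewrite mulr_suml; apply: eq_bigr => j _; rewrite mulrA.
rewrite /dinner; apply: cvgM; first exact: cvg_cst.
rewrite big_nat; under eq_fun do rewrite big_nat.
apply: cvg_big => [|i /andP[_ ilt]]; first exact: add_continuous.
by apply: cvgM; [apply: cg; apply: design_itv|exact: cvg_cst].
Qed.

Lemma sum_blocks (F : nat -> R) n L : (0 < n)%N -> (0 < L)%N ->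
  \sum_(1 <= j < L * n) F j =
  \sum_(1 <= j < n) F j + \sum_(1 <= l < L) \sum_(l * n <= j < l.+1 * n) F j.
Proof.
move=> n0; elim: L => // -[_ _|L IH _]; first by rewrite mul1n (@big_geq _ _ _ 1 1)// addr0.
rewrite (@big_cat_nat _ _ _ (L.+1 * n))//=; last 2 first.
- by rewrite muln_gt0.
- by rewrite leq_mul2r leqnSn orbT.
by rewrite IH// -addrA; congr (_ + _); rewrite [in RHS]big_nat_recr.
Qed.

(** Each block of [n] frequencies contributes one term, at [J l >= l n]. Split as [f_j j^beta] times
    [a_j j^(-beta) D_j]: the first factors have square sum at most [K^2], the squares of the second
    are at most [(M c2)^2 (l n)^(-1 - s)], summable in [l]. *)
Lemma aliasing_le psi M a p beta K c2 f (Af : R -> R) n k :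
  conj_basis_assumption psi M ->
  (forall j, (1 <= j)%N -> 0 <= a j <= c2 * j%:R `^ (- p)) ->
  0 < c2 -> 0 < p -> 0 < beta -> 1 / 2 < beta + p -> 0 < K ->
  Sbeta_ball beta K f ->
  (forall x, x \in `[0, 1] ->
     (fun N => \sum_(1 <= j < N) a j * f j * psi j x) @ \oo --> Af x) ->
  (2 <= n)%N -> (1 <= k < n)%N ->
  (dinner n Af (psi k) - a k * f k) ^+ 2 <=
    (K * (M * c2)) ^+ 2 * (1 + (2 * beta + 2 * p - 1)^-1) / n%:R.
Proof.
move=> [psi1 psi2] ha c20 p0 b0 bp K0 fK cAf n2 kn.
have n0 : (0 < n)%N by exact: ltn_trans n2.
have n0R : 0 < n%:R :> R by rewrite ltr0n.
have n1R : 1 <= n%:R :> R by rewrite ler1n.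
set s := 2 * beta + 2 * p - 1; have s0 : 0 < s by rewrite /s; lra.
have [kbar [kbarn kb]] := psi2 n k n2 kn.
(* Positivity of [M] is read off the strict bounds on the aliasing coefficient in the block
   [l = 1]. *)
have M0 : 0 < M by have /andP[h1 h2] := (kb 1 isT).1; exact: lt_trans h2.
pose J l := (l * n + kbar (odd l))%N.
pose D j := dinner n (psi j) (psi k).
have D_block l (F : nat -> R) : (1 <= l)%N ->
    \sum_(l * n <= j < l.+1 * n) F j * D j = F (J l) * D (J l).
  move=> l1; have [_ hz] := kb l l1.
  rewrite (@big_cat_nat _ _ _ (J l))//=; last 2 first.
  - by rewrite leq_addr.
  - by rewrite /J mulSn addnC leq_add2r ltnW.
  rewrite big_nat big1 ?add0r => [|j /andP[j1 j2]]; last first.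
    rewrite /D hz ?mulr0// ?(ltn_eqF j2)// j1/= (ltn_trans j2)//.
    by rewrite /J mulSn addnC ltn_add2r.
  rewrite big_ltn; last by rewrite /J mulSn addnC ltn_add2r.
  rewrite big_nat big1 ?addr0// => j /andP[j1 j2].
  by rewrite /D hz ?mulr0// ?(gtn_eqF j1)// j2 andbT (leq_trans _ (ltnW j1))// leq_addr.
pose B : R := M * c2 * Num.sqrt ((1 + s^-1) / n%:R).
have s'0 : 0 < (1 + s^-1) / n%:R by rewrite divr_gt0// addr_gt0// invr_gt0.
have B0 : 0 < B by rewrite !mulr_gt0 ?sqrtr_gt0.
have -> : (K * (M * c2)) ^+ 2 * (1 + s^-1) / n%:R = (K * B) ^+ 2.
  have -> : (K * B) ^+ 2 = (K * (M * c2)) ^+ 2 * Num.sqrt ((1 + s^-1) / n%:R) ^+ 2.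
    by rewrite /B; ring.
  by rewrite sqr_sqrtr ?(ltW s'0)//; ring.
rewrite -(real_normK (num_real (_ - _))) ler_pXn2r ?nnegrE ?normr_ge0 ?mulr_ge0 ?(ltW K0) ?(ltW B0)//.
have cD := @cvg_dinner_series _ _ _ (psi k) _ n0 cAf.
(* Along the multiples [L n] the series is cut exactly between blocks, and a bound uniform in [L]
   survives the limit. *)
have cD' := cvg_comp _ _ (cvg_mulnr n0) cD.
have cN : (fun L => `|\sum_(1 <= j < L * n) a j * f j * D j - a k * f k|) @ \oo -->
    `|dinner n Af (psi k) - a k * f k|.
  by apply: cvg_norm; apply: cvgB; [exact: cD'|exact: cvg_cst].
rewrite -(cvg_lim (@norm_hausdorff _ _) cN).
apply: limr_le; first exact: cvgP cN.
near=> L; have L0 : (0 < L)%N by near: L; exists 1%N.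
rewrite sum_blocks//.
have -> : \sum_(1 <= j < n) a j * f j * D j = a k * f k.
  rewrite (@eq_big_nat _ _ _ _ _ _ (fun j => a j * f j * (j == k)%:R)); last first.
    by move=> j jn; rewrite /D psi1.
  rewrite (bigD1_seq k) ?mem_index_iota ?iota_uniq//= eqxx mulr1 big1 ?addr0//.
  by move=> j /negbTE ->; rewrite mulr0.
rewrite addrAC subrr add0r.
have -> : \sum_(1 <= l < L) \sum_(l * n <= j < l.+1 * n) a j * f j * D j =
  \sum_(1 <= l < L) (f (J l) * (J l)%:R `^ beta) * (a (J l) * (J l)%:R `^ (- beta) * D (J l)).
  rewrite big_nat [RHS]big_nat; apply: eq_bigr => l /andP[l1 _].
  rewrite (D_block l (fun j => a j * f j))//.
  have J0 : 0 < (J l)%:R :> R by rewrite ltr0n addn_gt0 muln_gt0 l1 n0.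
  by rewrite powRN; field; rewrite gt_eqF// powR_gt0.
apply: sum_cauchy_schwarz => //.
- apply: le_trans (Sbeta_partial_le (L * n) K0 fK).
  rewrite /Sbeta_partial sum_blocks//; apply: ler_wpDl.
    by apply: sumr_ge0 => j _; rewrite mulr_ge0 ?sqr_ge0 ?powR_ge0.
  apply: ler_sum => l _.
  rewrite (bigD1_seq (J l)) ?iota_uniq//=; last first.
    by rewrite mem_index_iota leq_addr/= /J mulSn addnC ltn_add2r.
  rewrite exprMn -[X in _ * X <= _]powR_mulrn ?powR_ge0// -powRrM (mulrC beta) lerDl.
  by apply: sumr_ge0 => j _; rewrite mulr_ge0 ?sqr_ge0 ?powR_ge0.
- apply: (@le_trans _ _ (\sum_(1 <= l < L) (M * c2) ^+ 2 * n%:R^-1 * l%:R `^ (-1 - s))).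
    apply: ler_sum_nat => l /andP[l1 _].
    have l0R : 0 < l%:R :> R by rewrite ltr0n.
    have Jln : (l * n <= J l)%N by exact: leq_addr.
    have J1 : (1 <= J l)%N by apply: leq_trans Jln; rewrite muln_gt0 l1.
    have J0 : 0 < (J l)%:R :> R by rewrite ltr0n.
    have /andP[aJ0 aJ] := ha _ J1.
    have /andP[_ DM] := (kb l l1).1.
    have -> : (M * c2) ^+ 2 * n%:R^-1 * l%:R `^ (-1 - s) =
       (c2 ^+ 2 * (n%:R^-1 * l%:R `^ (-1 - s))) * M ^+ 2 by rewrite exprMn; ring.
    rewrite exprMn; apply: ler_pM; rewrite ?sqr_ge0//; last first.
      rewrite -(real_normK (num_real (D _))).
      by rewrite ler_pXn2r ?nnegrE ?normr_ge0 ?(ltW M0)// ltW.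
    apply: (@le_trans _ _ ((c2 * (J l)%:R `^ (- (beta + p))) ^+ 2)).
      rewrite ler_pXn2r ?nnegrE ?mulr_ge0 ?powR_ge0 ?(ltW c20)//.
      rewrite opprD addrC powRD; last by rewrite (gt_eqF J0) implybT.
      by rewrite mulrA ler_wpM2r ?powR_ge0.
    rewrite exprMn ler_pM2l ?exprn_gt0// -powR_mulrn ?powR_ge0// -powRrM.
    have -> : - (beta + p) * 2 = - (1 + s) by rewrite /s; lra.
    apply: (@le_trans _ _ ((l * n)%:R `^ (- (1 + s)))).
      by apply: powR_le_neg; rewrite ?ltr0n ?muln_gt0 ?l1 ?ler_nat//; lra.
    rewrite natrM powRM ?ler0n// mulrC opprD ler_wpM2r ?powR_ge0//.
    (* Of [n^(-1 - s)] only [n^(-1)] is kept: this already brings aliasing down to the noise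
       level. *)
    rewrite -[leRHS]powR_inv1 ?ler0n// ler_powR//; lra.
  rewrite -mulr_sumr /B [leRHS]exprMn sqr_sqrtr ?(ltW s'0)//.
  rewrite [X in _ <= _ * X]mulrC [leRHS]mulrA ler_wpM2l ?sum_powR_le//.
  by rewrite mulr_ge0 ?sqr_ge0 ?invr_ge0 ?ltW.
Unshelve. all: by [exact: ltW|end_near]. Qed.

End sequence_space.

(** * Rates *)

Section rates.
Context {R : realType}.
Implicit Types (alpha beta p : R) (rho : nat -> R) (n : nat).

(** Since [alpha / q <= 1], the second term dominates whenever the cap at 1 acts on [beta / q]. *)
Lemma eps_rate_rho1 alpha beta p n : 0 < alpha -> 0 < p -> (1 <= n)%N ->
  eps_rate alpha beta p (fun _ => 1) n =
    n%:R `^ (- (Num.min alpha beta / (2 * alpha + 2 * p + 1))).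
Proof.
move=> a0 p0 n1; rewrite /eps_rate expr1n !mul1r; set q := 2 * alpha + 2 * p + 1.
have q0 : 0 < q by rewrite /q; lra.
have n1R : 1 <= n%:R :> R by rewrite ler1n.
have aq : alpha / q <= 1 by rewrite ler_pdivrMr// /q; lra.
rewrite minr_pMl ?invr_ge0 ?(ltW q0)// -/q.
case: (leP (beta / q) 1) => h; case: (leP (alpha / q) (beta / q)) => h'.
- by rewrite max_r// ler_powR// lerN2.
- by rewrite max_l// ler_powR// lerN2 ltW.
- by rewrite max_r// ler_powR// lerN2.
- by exfalso; move: (lt_trans h h'); rewrite ltNge aq.
Qed.

Lemma powR_neg_sandwich (c1 c2 u v s : R) : 0 < c1 -> 0 < c2 -> 0 < u -> 0 <= s ->
  c1 * u <= v <= c2 * u ->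
  c2 `^ (- s) * u `^ (- s) <= v `^ (- s) <= c1 `^ (- s) * u `^ (- s).
Proof.
move=> c10 c20 u0 s0 /andP[h1 h2]; rewrite -!powRM ?(ltW c10) ?(ltW c20) ?(ltW u0)//.
have cu : 0 < c1 * u by rewrite mulr_gt0.
by rewrite !powR_le_neg// (lt_le_trans cu).
Qed.

(** This scaling balances the two terms: it makes [S] of order [n^(q/b)], and then both have order
    [n^(-beta/b)]. *)
Lemma eps_rate_optimal alpha beta p rho : 0 < alpha -> 0 < beta -> 0 < p ->
  beta <= 2 * alpha + 2 * p + 1 -> (forall n, 0 < rho n) ->
  asymp_seq rho (fun n => n%:R `^ ((alpha - beta) / (2 * beta + 2 * p + 1))) ->
  asymp_seq (eps_rate alpha beta p rho)
            (fun n => n%:R `^ (- (beta / (2 * beta + 2 * p + 1)))).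
Proof.
move=> a0 b0 p0; set q := 2 * alpha + 2 * p + 1; set b := 2 * beta + 2 * p + 1.
move=> bq rho0 [c1 [c2 [c10 [c20 h]]]].
have q0 : 0 < q by rewrite /q; lra.
have b'0 : 0 < b by rewrite /b; lra.
have c10' : 0 < c1 ^+ 2 by rewrite exprn_gt0.
have c20' : 0 < c2 ^+ 2 by rewrite exprn_gt0.
exists ((c2 ^+ 2) `^ (- (beta / q))).
exists ((c1 ^+ 2) `^ (- (beta / q)) + c2 * (c1 ^+ 2) `^ (- (alpha / q))).
split; first by rewrite powR_gt0.
split; first by rewrite addr_gt0 ?mulr_gt0 ?powR_gt0.
near=> n.
have n0R : 0 < n%:R :> R by rewrite ltr0n; near: n; exists 1%N.
have [r1 r2] : c1 * n%:R `^ ((alpha - beta) / b) <= rho n /\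
    rho n <= c2 * n%:R `^ ((alpha - beta) / b) by near: n.
rewrite /eps_rate -/q min_l; last by rewrite ler_pdivrMr// mul1r.
set S := rho n ^+ 2 * n%:R; set w := n%:R `^ ((alpha - beta) / b) in r1 r2.
have w0 : 0 < w by rewrite powR_gt0.
have r0 := rho0 n.
have uE : n%:R `^ (q / b) = w ^+ 2 * n%:R.
  rewrite -powR_mulrn ?(ltW w0)//.
  rewrite -powRrM -[X in _ = _ * X](powRr1 (ltW n0R)) -powRD.
    by congr (_ `^ _); rewrite /q /b; field; rewrite -/b gt_eqF.
  by rewrite (gt_eqF n0R) implybT.
have hS : c1 ^+ 2 * n%:R `^ (q / b) <= S <= c2 ^+ 2 * n%:R `^ (q / b).
  rewrite uE (mulrA (c1 ^+ 2)) (mulrA (c2 ^+ 2)) -!exprMn /S !ler_pM2r//.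
  by rewrite !ler_pXn2r ?nnegrE ?mulr_ge0 ?(ltW w0) ?(ltW c10) ?(ltW c20) ?(ltW r0)// r1 r2.
have u0 : 0 < n%:R `^ (q / b) :> R by rewrite powR_gt0.
have bq0 : 0 <= beta / q by rewrite divr_ge0 ?ltW.
have aq0 : 0 <= alpha / q by rewrite divr_ge0 ?ltW.
have /andP[l1 l2] := powR_neg_sandwich c10' c20' u0 bq0 hS.
have /andP[_ l3] := powR_neg_sandwich c10' c20' u0 aq0 hS.
have E1 : n%:R `^ (q / b) `^ (- (beta / q)) = n%:R `^ (- (beta / b)) :> R.
  by rewrite -powRrM; congr (_ `^ _); field; rewrite !gt_eqF.
have E2 : w * n%:R `^ (q / b) `^ (- (alpha / q)) = n%:R `^ (- (beta / b)) :> R.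
  rewrite -powRrM -powRD; last by rewrite (gt_eqF n0R) implybT.
  by congr (_ `^ _); field; rewrite !gt_eqF.
rewrite E1 in l1 l2; split; first by rewrite le_max l1.
rewrite ge_max mulrDl; apply/andP; split.
  by apply: le_trans l2 _; rewrite lerDl !mulr_ge0 ?powR_ge0 ?(ltW c20).
apply: (@le_trans _ _ (c2 * (c1 ^+ 2) `^ (- (alpha / q)) * n%:R `^ (- (beta / b)))).
  rewrite -E2 mulrACA mulrC [leRHS]mulrC mulrC.
  rewrite [leRHS]mulrC ler_pM ?powR_ge0 ?(ltW r0)//.
by rewrite lerDr mulr_ge0 ?powR_ge0.
Unshelve. all: by end_near. Qed.

Lemma cvg_powR_neg (s : R) : 0 < s -> (fun n => n%:R `^ (- s) : R) @ \oo --> 0.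
Proof.
move=> s0; apply/cvgrPdist_lt => e e0; near=> n.
have n0R : 0 < n%:R :> R by rewrite ltr0n; near: n; exists 1%N.
rewrite sub0r normrN ger0_norm ?powR_ge0//.
have nb : e `^ (- s^-1) < n%:R by near: n; exact: nbhs_infty_gtr.
have -> : e = (e `^ (- s^-1)) `^ (- s).
  by rewrite -powRrM mulrNN mulVf ?gt_eqF// powRr1 ?ltW.
have : 0 < e `^ (- s^-1) by rewrite powR_gt0.
move: nb; set t := e `^ _ => nb t0.
by rewrite !powRN ltf_pV2 ?posrE ?powR_gt0// gt0_ltr_powR// nnegrE ltW.
Unshelve. all: by end_near. Qed.

(** Eliminating [rho_n] through [S] makes the two terms [S^(-1)] and [S^g n^(-1/2)]. One falls and
    the other grows with [S], so for every scaling their maximum is at least the common value at the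
    crossing. *)
Lemma eps_rate_suboptimal alpha beta p rho : 0 < alpha -> 0 < beta -> 0 < p ->
  2 * alpha + 2 * p + 1 < beta -> (forall n, 0 < rho n) ->
  (fun n => n%:R `^ (- (beta / (2 * beta + 2 * p + 1))) / eps_rate alpha beta p rho n)
       @ \oo --> 0.
Proof.
move=> a0 b0 p0; set q := 2 * alpha + 2 * p + 1; set b := 2 * beta + 2 * p + 1 => qb rho0.
have q0 : 0 < q by rewrite /q; lra.
have b'0 : 0 < b by rewrite /b; lra.
(* [g = 1/2 - alpha/q]; the terms cross at [S = n^(e/2)], with value [n^(-e/2)]. The exponent [e/2]
   is [beta/b] evaluated at [beta = q], and [beta/b] increases with [beta], hence [dl > 0]. *)
pose g := (2 * p + 1) / (2 * q).
pose e := (1 + g)^-1.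
have g0 : 0 < g by rewrite divr_gt0; lra.
have e0 : 0 < e by rewrite invr_gt0; lra.
have e1 : e * (1 + g) = 1 by rewrite mulVf//; lra.
pose dl := beta / b - e / 2.
have dl0 : 0 < dl.
  have -> : dl = (2 * p + 1) * (beta - q) / (b * (2 * q + 2 * p + 1)).
    by rewrite /dl /e /g /b; field; rewrite -/b; apply/andP; split; rewrite gt_eqF//; lra.
  by rewrite divr_gt0 ?mulr_gt0 ?subr_gt0//; lra.
have lower n : (0 < n)%N -> n%:R `^ (- (e / 2)) <= eps_rate alpha beta p rho n.
  move=> n0; have n0R : 0 < n%:R :> R by rewrite ltr0n.
  rewrite /eps_rate -/q; set S := rho n ^+ 2 * n%:R.
  have S0 : 0 < S by rewrite mulr_gt0 ?exprn_gt0.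
  rewrite (min_r (_ : 1 <= beta / q)); last by rewrite ler_pdivlMr// mul1r ltW.
  have -> : rho n * S `^ (- (alpha / q)) = S `^ g * n%:R `^ (- (1/2)).
    have -> : rho n = S `^ (1/2) * n%:R `^ (- (1/2)).
      rewrite powRM ?exprn_ge0 ?ler0n ?(ltW (rho0 n))// -mulrA -powRD; last first.
        by rewrite (gt_eqF n0R) implybT.
      rewrite subrr powRr0 mulr1 -powR_mulrn ?(ltW (rho0 n))// -powRrM.
      by rewrite mulrA mulr1 divff// powRr1// ltW.
    rewrite mulrAC -powRD; last by rewrite (gt_eqF S0) implybT.
    by congr (_ `^ _ * _); rewrite /g /q; field; rewrite -/q gt_eqF.
  rewrite le_max; have [//|Sn] := leP (n%:R `^ (- (e / 2))) (S `^ (- 1)).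
  have nS : n%:R `^ (e / 2) < S.
    by move: Sn; rewrite !powRN powRr1 ?(ltW S0)// ltf_pV2 ?posrE ?powR_gt0.
  have -> : - (e / 2) = e / 2 * g - 1 / 2 by lra.
  rewrite powRD; last by rewrite (gt_eqF n0R) implybT.
  rewrite ler_pM2r ?powR_gt0// powRrM ge0_ler_powR ?nnegrE ?powR_ge0 ?(ltW g0)//; exact: ltW.
apply: (@squeeze_cvgr _ _ _ _ (fun=> 0) (fun n => n%:R `^ (- dl))).
- near=> n; have n0 : (0 < n)%N by near: n; exists 1%N.
  have n0R : 0 < n%:R :> R by rewrite ltr0n.
  have l := lower n n0; have l0 : 0 < n%:R `^ (- (e / 2)) :> R by rewrite powR_gt0.
  rewrite divr_ge0 ?powR_ge0 ?(le_trans (ltW l0))//=.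
  rewrite ler_pdivrMr ?(lt_le_trans l0)//.
  have -> : - (beta / b) = - dl + - (e / 2) by rewrite /dl; lra.
  rewrite powRD; last by rewrite (gt_eqF n0R) implybT.
  by rewrite ler_wpM2l ?powR_ge0.
- exact: cvg_cst.
- exact: cvg_powR_neg.
Unshelve. all: by end_near. Qed.

(** If [S <= n^q], the first term is at least [n^(-q t)] with [q t <= beta]. If [S > n^q], the
    square of the second is [S^((2 p + 1)/q) / n >= n^(2 p) >= 1]. *)
Lemma tail_le_eps_rate alpha beta p rho n : 0 < alpha -> 0 < beta -> 0 < p ->
  0 < rho n -> (0 < n)%N -> 1 <= rho n ^+ 2 * n%:R ->
  n%:R `^ (- beta) <= eps_rate alpha beta p rho n.
Proof.
move=> a0 b0 p0 r0 n0; rewrite /eps_rate; set q := 2 * alpha + 2 * p + 1; set S := _ * _ => S1.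
have q0 : 0 < q by rewrite /q; lra.
have S0 : 0 < S by lra.
have n0R : 0 < n%:R :> R by rewrite ltr0n.
have n1R : 1 <= n%:R :> R by rewrite ler1n.
rewrite le_max; have [Sn|nS] := leP S (n%:R `^ q); apply/orP; [left|right].
  set t := Num.min _ _.
  have t0 : 0 <= t by rewrite le_min divr_ge0//= ltW.
  have tb : q * t <= beta by rewrite mulrC -ler_pdivlMr// ge_min lexx.
  apply: (@le_trans _ _ ((n%:R `^ q) `^ (- t))).
    by rewrite -powRrM ler_powR// mulrN lerN2.
  rewrite !powRN lef_pV2 ?posrE ?powR_gt0//.
  by rewrite ge0_ler_powR// ?nnegrE ?powR_ge0// ltW.
apply: (@le_trans _ _ 1).
  by rewrite -[leRHS](powRr0 n%:R) ler_powR// oppr_le0 ltW.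
rewrite -(ler_pXn2r (n:=2)) ?nnegrE ?mulr_ge0 ?powR_ge0 ?(ltW r0)//.
rewrite expr1n exprMn -(@powR_mulrn _ _ 2 (powR_ge0 _ _)) -powRrM.
have -> : rho n ^+ 2 = S / n%:R by rewrite /S mulfK// gt_eqF.
rewrite mulrAC ler_pdivlMr// mul1r.
have -> : S * S `^ (- (alpha / q) * 2) = S `^ ((2 * p + 1) / q).
  rewrite -[X in X * _]powRr1 ?(ltW S0)// -powRD; last by rewrite (gt_eqF S0) implybT.
  by congr (_ `^ _); rewrite /q; field; rewrite -/q gt_eqF.
apply: (@le_trans _ _ ((n%:R `^ q) `^ ((2 * p + 1) / q))).
  rewrite -powRrM mulrC divfK ?gt_eqF// -[leLHS]powRr1// ler_powR//; lra.
rewrite ge0_ler_powR ?nnegrE ?powR_ge0 ?(ltW S0) ?(ltW nS)//.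
by rewrite divr_ge0 ?(ltW q0)//; lra.
Qed.

End rates.

(** * Posterior contraction *)

Section moments.
Context {R : realType}.

(** The variance enters the bounds only as a finite nonnegative constant, so its value is left
    uncomputed. *)
Definition normal_var : R := fine (\int[normal_prob (0 : R) 1]_x (x ^+ 2)%:E)%E.

Lemma normal_varE : (\int[normal_prob (0 : R) 1]_x (x ^+ 2)%:E)%E = normal_var%:E.
Proof. by rewrite /normal_var fineK// integrable_fin_num//; exact: normal_integrable_sqr. Qed.

Lemma normal_var_ge0 : 0 <= normal_var.
Proof. by rewrite fine_ge0// integral_ge0// => x _; rewrite lee_fin sqr_ge0. Qed.

Context {d} {T : measurableType d} (P : probability T R) (X : nat -> T -> R).
Context (iidX : iid_std_normal P X).

Lemma measurable_iid_affine (b : R) (r : seq nat) (c : nat -> R) :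
  measurable_fun setT (fun w => (b + \sum_(i <- r) X i w * c i) ^+ 2).
Proof.
apply: measurable_funX; apply: measurable_funD => //.
by apply: measurable_sum => i; apply: measurable_funM => //; exact: iidX.1.
Qed.

(** The inequality [(b + v)^2 <= 2 b^2 + 2 v^2] stands in for the exact variance decomposition. The
    list [r k] is a singleton for posterior draws and the design indices for the noise. *)
Lemma iid_affine_second_moment (I : Type) (K : seq I) (r : I -> seq nat) (b : I -> R)
    (c : I -> nat -> R) : (forall k, uniq (r k)) ->
  (\int[P]_w (\sum_(k <- K) (b k + \sum_(i <- r k) X i w * c k i) ^+ 2)%:E <=
   (\sum_(k <- K) (2 * b k ^+ 2 + 2 * (normal_var * \sum_(i <- r k) c k i ^+ 2)))%:E)%E.
Proof.
move=> ur; under eq_integral do rewrite -sumEFin.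
rewrite ge0_integral_sum//; last 2 first.
- by move=> k; apply/measurable_EFinP; exact: measurable_iid_affine.
- by move=> k w _; rewrite lee_fin sqr_ge0.
rewrite -sumEFin; apply: lee_sum => k _.
apply: (@le_trans _ _ (\int[P]_w ((2 * b k ^+ 2)%:E +
    2%:E * ((\sum_(i <- r k) X i w * c k i) ^+ 2)%:E))%E).
  apply: ge0_le_integral_nomeas => w; first by rewrite lee_fin sqr_ge0.
  rewrite -EFinM -EFinD lee_fin; set v := \sum_(i <- _) _.
  have := sqr_ge0 (b k - v); nra.
have m2 : measurable_fun setT (fun w => ((\sum_(i <- r k) X i w * c k i) ^+ 2)%:E).
  apply/measurable_EFinP; have := @measurable_iid_affine 0 (r k) (c k).
  by under eq_fun do rewrite add0r.
rewrite ge0_integralD//; last 3 first.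
- by move=> w _; rewrite lee_fin mulr_ge0 ?sqr_ge0.
- by move=> w _; rewrite -EFinM lee_fin mulr_ge0 ?sqr_ge0.
- exact: measurable_funeM.
rewrite integral_cst// [X in (_ * X)%E](@probability_setT _ _ _ P) mule1 [leRHS]EFinD; apply: leeD2l.
rewrite ge0_integralZl_EFin//; last by move=> w _; rewrite lee_fin sqr_ge0.
by rewrite (iid_linear_second_moment iidX (c k) (ur k)) normal_varE -!EFinM lee_fin (mulrC normal_var).
Qed.

End moments.

(** * Markov bounds for the posterior probability and its expectation *)

Section posterior.
Context {R : realType}.
Implicit Types (f g : nat -> R).

Lemma H1dist_split f g (n : nat) : (1 <= n)%N ->
  (forall k, (n <= k)%N -> g k = 0) ->
  cvgn (fun N => \sum_(n <= k < N) f k ^+ 2) ->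
  H1dist g f = Num.sqrt (\sum_(1 <= k < n) (g k - f k) ^+ 2 +
                         limn (fun N => \sum_(n <= k < N) f k ^+ 2)).
Proof.
move=> n1 gn cf; congr Num.sqrt; apply: cvg_lim => //.
have : (fun N => \sum_(1 <= k < n) (g k - f k) ^+ 2 + \sum_(n <= k < N) f k ^+ 2) @ \oo -->
    \sum_(1 <= k < n) (g k - f k) ^+ 2 + limn (fun N => \sum_(n <= k < N) f k ^+ 2).
  by apply: cvgD; [exact: cvg_cst|exact: cf].
apply: cvg_trans; apply: near_eq_cvg; near=> N.
have nN : (n <= N)%N by near: N; exact: nbhs_infty_ge.
rewrite [RHS](@big_cat_nat _ _ _ n)//=; congr (_ + _).
by apply: eq_big_nat => k /andP[nk _]; rewrite gn// sub0r sqrrN.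
Unshelve. all: by end_near. Qed.

Definition post_gain (a rho : nat -> R) (alpha : R) (n k : nat) : R :=
  n%:R * a k * lambda rho alpha n k / (n%:R * a k ^+ 2 * lambda rho alpha n k + 1).

Context (a rho : nat -> R) (alpha : R) (n : nat).

Lemma post_prob_le (u f : nat -> R) (r : R) d (T : measurableType d)
    (Q : probability T R) (Z : nat -> T -> R) :
  iid_std_normal Q Z -> (1 <= n)%N -> 0 < r ->
  cvgn (fun N => \sum_(n <= k < N) f k ^+ 2) ->
  (post_prob a rho alpha n u Q Z f r <=
   ((r ^+ 2)^-1 * (\sum_(1 <= k < n) (2 * (post_gain a rho alpha n k * u k - f k) ^+ 2 +
                     2 * (normal_var * post_sd a rho alpha n k ^+ 2)) +
                   limn (fun N => \sum_(n <= k < N) f k ^+ 2)))%:E)%E.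
Proof.
move=> iidZ n1 r0 cf; set tl := limn _.
have tl0 : 0 <= tl.
  by apply: limr_ge => //; apply: nearW => N; apply: sumr_ge0 => k _; exact: sqr_ge0.
pose m k := post_gain a rho alpha n k * u k - f k.
pose s k := post_sd a rho alpha n k.
pose G w := \sum_(1 <= k < n) (m k + \sum_(i <- [:: k]) Z i w * s k) ^+ 2.
have G0 w : 0 <= G w by apply: sumr_ge0 => k _; exact: sqr_ge0.
have mG : measurable_fun setT G.
  apply: measurable_sum => k.
  exact: (measurable_iid_affine iidZ (m k) [:: k] (fun=> s k)).
have mH : measurable_fun setT (fun w => (G w + tl)%:E).
  by apply/measurable_EFinP; exact: measurable_funD.
have r20 : 0 < r ^+ 2 by rewrite exprn_gt0.
(* The event becomes a superlevel set of a finite sum plus a constant, a measurable function to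
   which Markov's inequality applies. *)
have AE : [set w | r <= H1dist (post_draw a rho alpha n u Z w) f] =
    [set w | ((r ^+ 2)%:E <= `|(G w + tl)%:E|)%E].
  apply/seteqP; suff H w : (r <= H1dist (post_draw a rho alpha n u Z w) f) =
      ((r ^+ 2)%:E <= `|(G w + tl)%:E|)%E by split => w /=; rewrite H.
  rewrite (@H1dist_split _ _ n)//; last first.
    by move=> k nk; rewrite /post_draw /post_mean /post_sd ltnNge nk/= mul0r addr0.
  rewrite gee0_abs ?lee_fin ?addr_ge0// -/tl.
  have -> : \sum_(1 <= k < n) (post_draw a rho alpha n u Z w k - f k) ^+ 2 = G w.
    apply: eq_big_nat => k /andP[_ kn].
    by rewrite big_seq1 /post_draw /post_mean kn /m /post_gain /s; congr (_ ^+ 2); ring.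
  by rewrite -(ler_sqrt _ (addr_ge0 (G0 w) tl0)) sqrtr_sqr ger0_norm// ltW.
rewrite /post_prob AE.
have := @le_integral_abse _ _ _ Q setT measurableT _ _ mH r20.
rewrite setTI => h.
rewrite [leRHS]EFinM lee_pdivlMl// (le_trans h)//.
under eq_integral do rewrite gee0_abs ?lee_fin ?addr_ge0// EFinD.
rewrite ge0_integralD//; last 2 first.
- by move=> w _; rewrite lee_fin.
- exact/measurable_EFinP.
rewrite integral_cst// [X in (_ * X)%E](@probability_setT _ _ _ Q) mule1 [leRHS]EFinD; apply: leeD2r.
have := iid_affine_second_moment iidZ (index_iota 1 n) m (fun k _ => s k)
  (fun k => isT : uniq [:: k]).
move=> /le_trans; apply; rewrite lee_fin; apply: ler_sum => k _.
by rewrite big_seq1.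
Qed.

(** The square is split twice, at the posterior draw and at the noise: the data terms carry the
    factor 4, the posterior variance only 2. *)
Lemma exp_post_prob_le (psi : nat -> R -> R) (Af : R -> R) (f : nat -> R) (r : R)
    d1 (T1 : measurableType d1) (P : probability T1 R) (xi : nat -> T1 -> R)
    d2 (T2 : measurableType d2) (Q : probability T2 R) (Z : nat -> T2 -> R) :
  iid_std_normal P xi -> iid_std_normal Q Z -> (1 <= n)%N -> 0 < r ->
  cvgn (fun N => \sum_(n <= k < N) f k ^+ 2) ->
  (forall k, (1 <= k < n)%N -> dinner n (psi k) (psi k) = 1) ->
  (exp_post_prob a rho alpha psi Af P xi Q Z n f r <=
   ((r ^+ 2)^-1 * (\sum_(1 <= k < n)
       (4 * (post_gain a rho alpha n k * dinner n Af (psi k) - f k) ^+ 2 +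
        4 * (normal_var * (post_gain a rho alpha n k ^+ 2 / n%:R)) +
        2 * (normal_var * post_sd a rho alpha n k ^+ 2)) +
      limn (fun N => \sum_(n <= k < N) f k ^+ 2)))%:E)%E.
Proof.
move=> iidP iidQ n1 r0 cf psi1; set tl := limn _.
have n0R : 0 < n%:R :> R by rewrite ltr0n.
have tl0 : 0 <= tl.
  by apply: limr_ge => //; apply: nearW => N; apply: sumr_ge0 => k _; exact: sqr_ge0.
have V0 := @normal_var_ge0 R.
have r20 : 0 < r ^+ 2 by rewrite exprn_gt0.
pose t k := post_gain a rho alpha n k.
pose b k := t k * dinner n Af (psi k) - f k.
pose c k i := t k * psi k (design n i) / n%:R.
pose s k := post_sd a rho alpha n k.
pose G w := \sum_(1 <= k < n) (b k + \sum_(i <- index_iota 1 n.+1) xi i w * c k i) ^+ 2.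
have G0 w : 0 <= G w by apply: sumr_ge0 => k _; exact: sqr_ge0.
have mG : measurable_fun setT G.
  apply: measurable_sum => k.
  exact: (measurable_iid_affine iidP (b k) _ (c k)).
pose L := \sum_(1 <= k < n) 2 * (normal_var * s k ^+ 2) + tl.
have L0 : 0 <= L.
  by rewrite addr_ge0//; apply: sumr_ge0 => k _; rewrite mulr_ge0// mulr_ge0// sqr_ge0.
have ur : forall k : nat, uniq (index_iota 1 n.+1) by move=> _; exact: iota_uniq.
rewrite /exp_post_prob.
apply: (@le_trans _ _ (\int[P]_w ((r ^+ 2)^-1%:E * (2%:E * (G w)%:E + L%:E)))%E).
  apply: ge0_le_integral_nomeas => w; first by rewrite /post_prob.
  apply: le_trans (post_prob_le _ iidQ n1 r0 cf) _.
  rewrite -[leRHS]/(((r ^+ 2)^-1 * (2 * G w + L))%:E) lee_fin -/tl ler_pM2l ?invr_gt0//.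
  rewrite big_split/= -addrA lerD2r -mulr_sumr ler_pM2l// /G.
  apply: ler_sum_nat => k kn; rewrite -/(t k) /b.
  have -> : dataU psi Af xi n w k =
      dinner n Af (psi k) + n%:R^-1 * \sum_(1 <= i < n.+1) xi i w * psi k (design n i).
    rewrite /dataU /dinner -mulrDr -big_split/=; congr (_ * _).
    by apply: eq_bigr => i _; rewrite /obsY mulrDl.
  have -> : \sum_(1 <= i < n.+1) xi i w * c k i =
      t k * (n%:R^-1 * \sum_(1 <= i < n.+1) xi i w * psi k (design n i)).
    by rewrite !mulr_sumr; apply: eq_bigr => i _; rewrite /c; ring.
  by rewrite mulrDr addrAC.
rewrite ge0_integralZl_EFin//; last 3 first.
- by move=> w _; rewrite -EFinM -EFinD lee_fin addr_ge0 ?mulr_ge0.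
- apply: emeasurable_funD => //; apply: measurable_funeM; exact/measurable_EFinP.
- by rewrite invr_ge0 ltW.
rewrite EFinM lee_pmul2l ?lte_fin ?invr_gt0//.
rewrite ge0_integralD//; last 2 first.
- by move=> w _; rewrite -EFinM lee_fin mulr_ge0.
- by apply: measurable_funeM; exact/measurable_EFinP.
rewrite integral_cst// [X in (_ * X)%E](@probability_setT _ _ _ P) mule1.
rewrite ge0_integralZl_EFin//; last 2 first.
- by move=> w _; rewrite lee_fin.
- exact/measurable_EFinP.
have h := iid_affine_second_moment iidP (index_iota 1 n) b c ur.
apply: (@le_trans _ _ (2%:E * (\sum_(1 <= k < n) (2 * b k ^+ 2 +
   2 * (normal_var * \sum_(1 <= i < n.+1) c k i ^+ 2)))%:E + L%:E)%E).
  by apply: leeD2r; rewrite lee_pmul2l //.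
rewrite -EFinM -EFinD lee_fin /L addrA lerD2r -/tl mulr_sumr -big_split/=.
apply: ler_sum_nat => k kn.
(* Normalisation of [psi k] on the design gives the transformed noise variance of order [1 / n]. *)
have -> : \sum_(1 <= i < n.+1) c k i ^+ 2 = t k ^+ 2 / n%:R.
  transitivity (t k ^+ 2 / n%:R * dinner n (psi k) (psi k)); last by rewrite psi1// mulr1.
  rewrite /dinner !mulr_sumr; apply: eq_bigr => i _.
  by rewrite /c; field; rewrite gt_eqF.
rewrite -/(t k) -/(s k) -/(b k) le_eqVlt; apply/orP; left; apply/eqP; ring.
Qed.

End posterior.

(** * Uniform risk bound over the Sobolev ball and conclusion *)

Section contraction.
Context {R : realType}.

(** The threshold is lowered one index at a time, absorbing the ratio [u N / v N] into the
    constants, until it reaches 1, where the sums start. *)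
Lemma asymp_seq_all (u v : nat -> R) :
  (forall k, (1 <= k)%N -> 0 < u k) -> (forall k, (1 <= k)%N -> 0 < v k) ->
  asymp_seq u v ->
  exists c1 c2 : R, [/\ 0 < c1, 0 < c2 &
    forall k, (1 <= k)%N -> c1 * v k <= u k <= c2 * v k].
Proof.
move=> u0 v0 [c1 [c2 [c10 [c20 [N _ h]]]]].
have {}h k : (N <= k)%N -> (1 <= k)%N -> c1 * v k <= u k <= c2 * v k.
  by move=> Nk _; apply/andP; exact: h.
elim: N c1 c2 c10 c20 h => [|N IH] c1 c2 c10 c20 h.
  by exists c1, c2; split => // k; exact: h.
have [N0|N0] := posnP N; last first.
  apply: (IH (Num.min c1 (u N / v N)) (Num.max c2 (u N / v N))).
  - by rewrite lt_min c10 divr_gt0 ?u0 ?v0.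
  - by rewrite lt_max c20.
  move=> k; rewrite leq_eqVlt => /predU1P[<- _|Nk k1].
    have vN := v0 _ N0.
    rewrite -ler_pdivlMr// ge_min lexx orbT/=.
    by rewrite -ler_pdivrMr// le_max lexx orbT.
  have /andP[h1 h2] := h k Nk k1; have vk := v0 _ k1.
  rewrite (le_trans _ h1)/=; last by rewrite ler_pM2r// ge_min lexx.
  by rewrite (le_trans h2)// ler_pM2r// le_max lexx.
by exists c1, c2; split => // k k1; apply: h; rewrite ?N0.
Qed.

Let V := @normal_var R.

(** Stated with abstract variables to keep the linear arithmetic small: 8 is [4 * 2] from splitting
    [A], and 6 is [4 + 2] from noise plus posterior variance. *)
Let combine (A T2 F2 Vg Vs Cs X WY : R) :
  A <= 2 * T2 + 2 * F2 -> T2 <= Cs -> F2 <= X -> Vg <= Vs -> 8 * Cs + 6 * Vs <= WY ->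
  4 * A + 4 * Vg + 2 * Vs <= 8 * X + WY.
Proof. lra. Qed.

Let sqrrB_le (x y : R) : (x - y) ^+ 2 <= 2 * x ^+ 2 + 2 * y ^+ 2.
Proof. by have := sqr_ge0 (x + y); nra. Qed.

Lemma posterior_risk_le (a : nat -> R) (p : R) (psi : nat -> R -> R) (M : R)
    (Aop : (nat -> R) -> R -> R) (alpha beta K : R) :
  0 < p -> 0 < beta -> 1 / 2 < beta + p -> 0 < alpha ->
  conj_basis_assumption psi M ->
  (forall k, (1 <= k)%N -> 0 < a k) ->
  asymp_seq a (fun k => k%:R `^ (- p)) ->
  (forall f : nat -> R, in_Sbeta beta f ->
     forall x : R, x \in `[0, 1] ->
     (fun N => \sum_(1 <= k < N) a k * f k * psi k x) @ \oo --> Aop f x) ->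
  0 < K ->
  exists2 C, 0 < C & forall rho n f, 0 < rho n -> (2 <= n)%N ->
    1 <= rho n ^+ 2 * n%:R -> Sbeta_ball beta K f ->
    \sum_(1 <= k < n)
       (4 * (post_gain a rho alpha n k * dinner n (Aop f) (psi k) - f k) ^+ 2 +
        4 * (V * (post_gain a rho alpha n k ^+ 2 / n%:R)) +
        2 * (V * post_sd a rho alpha n k ^+ 2)) +
      limn (fun N => \sum_(n <= k < N) f k ^+ 2)
    <= C * eps_rate alpha beta p rho n ^+ 2.
Proof.
move=> p0 b0 bp al0 psiM a0 aasymp AopE K0.
have [c1 [c2 [c10 c20 ac]]] : exists c1 c2 : R, [/\ 0 < c1, 0 < c2 &
    forall k, (1 <= k)%N -> c1 * k%:R `^ (- p) <= a k <= c2 * k%:R `^ (- p)].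
  by apply: asymp_seq_all => // k k1; rewrite powR_gt0// ltr0n.
pose q := 2 * alpha + 2 * p + 1; have q0 : 0 < q by rewrite /q; lra.
have V0 : 0 <= V := @normal_var_ge0 R.
have c0 : 0 < c1 ^+ 2 by rewrite exprn_gt0.
have s0 : 0 < 2 * alpha by rewrite mulr_gt0.
have sq : 2 * alpha + 1 <= q by rewrite /q; lra.
have [C1 C10 hC1] := sum_spread_le s0 sq c0.
have bias := bias_weight_le b0 q0 c0.
set C2 := 1 + (c1 ^+ 2)^-1 in bias.
pose CR := (K * (M * c2)) ^+ 2 * (1 + (2 * beta + 2 * p - 1)^-1).
have CR0 : 0 <= CR.
  by rewrite mulr_ge0 ?sqr_ge0// addr_ge0// invr_ge0; lra.
(* The summands pay for the shrinkage bias, for aliasing with noise and posterior variance, and for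
   the truncated tail. *)
exists (8 * (C2 * K) ^+ 2 + (8 * CR + 6 * V) * C1 + K ^+ 2).
  apply: ltr_wpDl; last by rewrite exprn_gt0.
  apply: addr_ge0; first by apply: mulr_ge0; rewrite ?sqr_ge0.
  by apply: mulr_ge0; rewrite ?(ltW C10)// addr_ge0// mulr_ge0.
move=> rho n f r0 n2 S1 fK.
have n0 : (0 < n)%N by exact: ltn_trans n2.
have n0R : 0 < n%:R :> R by rewrite ltr0n.
set S := rho n ^+ 2 * n%:R in S1.
have S0 : 0 < S by lra.
set eps := eps_rate _ _ _ _ _.
pose e1 := S `^ (- Num.min (beta / q) 1).
pose e2 := rho n * S `^ (- (alpha / q)).
have e1le : e1 <= eps by rewrite /eps /eps_rate le_max lexx.
have e2le : e2 <= eps by rewrite /eps /eps_rate le_max lexx orbT.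
have e10 : 0 < e1 by rewrite powR_gt0.
have e20 : 0 < e2 by rewrite mulr_gt0 ?powR_gt0.
have sq_le x : 0 < x -> x <= eps -> x ^+ 2 <= eps ^+ 2.
  by move=> x0 xe; rewrite ler_pXn2r// nnegrE ?(ltW x0)// (le_trans (ltW x0)).
pose lam k := lambda rho alpha n k.
pose w k := n%:R * a k ^+ 2 * lam k.
(* This is [w k + 1] with [a k] replaced by its lower bound [c1 k^(-p)], the denominator treated by
   [sum_spread_le] and [bias_weight_le]. *)
pose Dk k := c1 ^+ 2 * (S * k%:R `^ (- q)) + 1.
have lam0 k : (1 <= k)%N -> 0 < lam k.
  by move=> k1; rewrite /lam /lambda mulr_gt0 ?exprn_gt0// powR_gt0// ltr0n.
have w0 k : (1 <= k)%N -> 0 < w k.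
  by move=> k1; rewrite /w mulr_gt0 ?lam0// mulr_gt0// exprn_gt0// a0.
have Dw k : (1 <= k)%N -> Dk k <= w k + 1.
  move=> k1; rewrite lerD2r /w /lam /lambda.
  have k0 : 0 < k%:R :> R by rewrite ltr0n.
  have -> : c1 ^+ 2 * (S * k%:R `^ (- q)) =
      n%:R * (c1 * k%:R `^ (- p)) ^+ 2 * (rho n ^+ 2 * k%:R `^ (-1 - 2 * alpha)).
    have -> : k%:R `^ (- q) = k%:R `^ (- p) * k%:R `^ (- p) * k%:R `^ (-1 - 2 * alpha) :> R.
      have -> : - q = - p + - p + (-1 - 2 * alpha) by rewrite /q; lra.
      by rewrite !powRD// (gt_eqF k0) implybT.
    by rewrite /S; ring.
  rewrite ler_pM2r ?mulr_gt0 ?exprn_gt0 ?powR_gt0// ler_pM2l//.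
  have /andP[h1 _] := ac _ k1.
  by rewrite ler_pXn2r// nnegrE ?mulr_ge0 ?powR_ge0 ?(ltW c10)// ltW// a0.
have D0 k : 0 < Dk k.
  by rewrite ltr_wpDl// mulr_ge0 ?sqr_ge0// mulr_ge0 ?powR_ge0// ltW.
have sdE k : (1 <= k < n)%N -> post_sd a rho alpha n k ^+ 2 = lam k / (w k + 1).
  move=> /andP[k1 kn]; rewrite /post_sd kn sqr_sqrtr// divr_ge0//.
    by rewrite ltW// lam0.
  by rewrite addr_ge0// -/(lam k) -/(w k) ltW// w0.
have tE k : post_gain a rho alpha n k = n%:R * a k * lam k / (w k + 1) by [].
have t2le k : (1 <= k < n)%N ->
    post_gain a rho alpha n k ^+ 2 / n%:R <= post_sd a rho alpha n k ^+ 2.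
  move=> kn; have k1 : (1 <= k)%N by case/andP: kn.
  have wk := w0 _ k1; have lk := lam0 _ k1.
  rewrite sdE// tE.
  have -> : (n%:R * a k * lam k / (w k + 1)) ^+ 2 / n%:R =
      lam k / (w k + 1) * (w k / (w k + 1)).
    by rewrite /w; field; rewrite -/(w k); apply/andP; split; rewrite gt_eqF//; lra.
  rewrite ler_piMr ?divr_ge0 ?(ltW lk)//; first lra.
  by rewrite ler_pdivrMr; lra.
(* Since [a_k t_k = w_k / (w_k + 1)], the error separates into filtered aliasing and the shrinkage
   remainder [f_k / (w_k + 1)]. *)
have bE k : (1 <= k)%N -> post_gain a rho alpha n k * dinner n (Aop f) (psi k) - f k =
    post_gain a rho alpha n k * (dinner n (Aop f) (psi k) - a k * f k) - f k / (w k + 1).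
  move=> k1; have wk := w0 _ k1; rewrite tE /w; field; rewrite -/(w k) gt_eqF//; lra.
have RE k : (1 <= k < n)%N ->
    (dinner n (Aop f) (psi k) - a k * f k) ^+ 2 <= CR / n%:R.
  move=> kn; apply: (aliasing_le psiM _ c20 p0 b0 bp K0 fK _ n2 kn).
    by move=> j j1; have /andP[_ ->] := ac _ j1; rewrite ltW// a0.
  exact: AopE fK.1.
apply: (@le_trans _ _ (\sum_(1 <= k < n)
    (8 * (C2 * e1) ^+ 2 * (f k ^+ 2 * k%:R `^ (2 * beta)) +
     (8 * CR + 6 * V) * (rho n ^+ 2 * (k%:R `^ (-1 - 2 * alpha) / Dk k))) +
     (K * n%:R `^ (- beta)) ^+ 2)).
  apply: lerD; last first.
    apply: limr_le; first exact: Sbeta_tail_cvg (ltW b0) K0 n0 fK.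
    by apply: nearW => N; exact: Sbeta_tail_le (ltW b0) K0 n0 fK.
  apply: ler_sum_nat => k kn; have k1 : (1 <= k)%N by case/andP: kn.
  have k0 : 0 < k%:R :> R by rewrite ltr0n.
  have wk := w0 _ k1; have lk := lam0 _ k1.
  have sd0 := sqr_ge0 (post_sd a rho alpha n k).
  have sdle : post_sd a rho alpha n k ^+ 2 <= rho n ^+ 2 * (k%:R `^ (-1 - 2 * alpha) / Dk k).
    rewrite sdE// mulrA -/(lambda rho alpha n k) -/(lam k) ler_pM2l//.
    by rewrite lef_pV2 ?posrE ?Dw//; lra.
  have tR : (post_gain a rho alpha n k * (dinner n (Aop f) (psi k) - a k * f k)) ^+ 2 <=
      CR * post_sd a rho alpha n k ^+ 2.
    rewrite exprMn; apply: (@le_trans _ _ (post_gain a rho alpha n k ^+ 2 * (CR / n%:R))).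
      by rewrite ler_wpM2l ?sqr_ge0 ?RE.
    by rewrite mulrCA ler_wpM2l// t2le.
  have fb : (f k / (w k + 1)) ^+ 2 <= (C2 * e1) ^+ 2 * (f k ^+ 2 * k%:R `^ (2 * beta)).
    have -> : (f k / (w k + 1)) ^+ 2 =
      (k%:R `^ (- beta) / (w k + 1)) ^+ 2 * (f k ^+ 2 * k%:R `^ (2 * beta)).
      have -> : k%:R `^ (2 * beta) = (k%:R `^ beta) ^+ 2 :> R.
        by rewrite -powR_mulrn ?powR_ge0// -powRrM mulrC.
      rewrite powRN; field; rewrite !gt_eqF ?powR_gt0//; lra.
    apply: ler_wpM2r; first by rewrite mulr_ge0 ?sqr_ge0 ?powR_ge0.
    have C20 : 0 < C2 by rewrite addr_gt0// invr_gt0.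
    rewrite ler_pXn2r ?nnegrE ?(mulr_ge0 (ltW C20) (ltW e10))//; last first.
      by rewrite divr_ge0 ?powR_ge0//; lra.
    apply: le_trans (bias _ _ S1 k1).
    rewrite ler_pM2l ?powR_gt0// lef_pV2 ?posrE ?D0 ?Dw//; lra.
  rewrite bE//; have t2 := t2le _ kn.
  set T := post_gain _ _ _ _ _ * _ in tR *; set F := f k / _ in fb *.
  set sd := post_sd _ _ _ _ _ ^+ 2 in sdle tR t2 sd0 *.
  set g2 := post_gain _ _ _ _ _ ^+ 2 / _ in t2 *.
  have h2 : V * g2 <= V * sd by rewrite ler_wpM2l.
  rewrite -[8 * _ * (f k ^+ 2 * _)]mulrA.
  apply: (combine (sqrrB_le T F) tR fb h2).
  have -> : 8 * (CR * sd) + 6 * (V * sd) = (8 * CR + 6 * V) * sd by ring.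
  by rewrite ler_wpM2l// addr_ge0// mulr_ge0.
rewrite big_split/= -!mulr_sumr [leRHS]mulrDl.
apply: lerD; last first.
  rewrite exprMn ler_pM2l ?exprn_gt0//; apply: sq_le; first by rewrite powR_gt0.
  exact: tail_le_eps_rate.
rewrite [leRHS]mulrDl; apply: lerD.
  have := Sbeta_partial_le n K0 fK; rewrite /Sbeta_partial => h.
  apply: (@le_trans _ _ (8 * (C2 * e1) ^+ 2 * K ^+ 2)).
    by rewrite ler_wpM2l// mulr_ge0 ?sqr_ge0.
  have -> : 8 * (C2 * e1) ^+ 2 * K ^+ 2 = 8 * (C2 * K) ^+ 2 * e1 ^+ 2 by ring.
  by rewrite ler_wpM2l ?sq_le// mulr_ge0 ?sqr_ge0.
rewrite -[leRHS]mulrA; apply: ler_wpM2l; first by rewrite addr_ge0// mulr_ge0.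
apply: (@le_trans _ _ (C1 * e2 ^+ 2)); last by rewrite ler_pM2l// sq_le.
apply: le_trans (ler_wpM2l (sqr_ge0 (rho n)) (hC1 S n S1)) _.
rewrite /e2 exprMn -[X in _ <= _ * (_ * X)]powR_mulrn ?powR_ge0// -powRrM.
rewrite mulrCA le_eqVlt; apply/orP; left; apply/eqP; congr (_ * (_ * (_ `^ _))).
by field; rewrite gt_eqF.
Qed.

End contraction.

Theorem mainTheorem2 (R : realType)
    (a : nat -> R) (p : R) (psi : nat -> R -> R) (M : R)
    (Aop : (nat -> R) -> R -> R) (alpha beta : R)
    (d1 : measure_display) (T1 : measurableType d1) (P : probability T1 R)
    (xi : nat -> T1 -> R)
    (d2 : measure_display) (T2 : measurableType d2) (Q : probability T2 R)
    (Z : nat -> T2 -> R) :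
  (* singular values a_k > 0, mildly ill-posed: a_k ~ k^{-p}, p > 0 *)
  (forall k, (1 <= k)%N -> 0 < a k) ->
  0 < p ->
  asymp_seq a (fun k => k%:R `^ (- p)) ->
  (* standing assumption on the conjugate basis psi_k = A phi_k / a_k *)
  conj_basis_assumption psi M ->
  (* Af is continuous on [0,1] and Af(x) = sum_k a_k f_k psi_k(x) *)
  (forall f : nat -> R, in_Sbeta beta f ->
     {within `[0, 1], continuous (Aop f)} /\
     forall x : R, x \in `[0, 1] ->
       (fun N => \sum_(1 <= k < N) a k * f k * psi k x) @ \oo --> Aop f x) ->
  0 < beta -> 1 / 2 < beta + p -> 0 < alpha ->
  (* noise xi_i i.i.d. N(0,1); Z is an auxiliary i.i.d. N(0,1) sequence used to
     realise the posterior distribution *)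
  iid_std_normal P xi -> iid_std_normal Q Z ->
  (* main contraction statement *)
  (forall rho : nat -> R, (forall n, 0 < rho n) ->
     (fun n => rho n ^+ 2 * n%:R) @ \oo --> +oo ->
     forall (K : R) (Mn : nat -> R), 0 < K -> Mn @ \oo --> +oo ->
     (fun n => ereal_sup
        [set exp_post_prob a rho alpha psi (Aop f0) P xi Q Z n f0
                           (Mn n * eps_rate alpha beta p rho n)
        | f0 in Sbeta_ball beta K]) @ \oo --> 0%E)
  /\
  (* (i) rho_n = 1 *)
  (forall n : nat, (1 <= n)%N ->
     eps_rate alpha beta p (fun _ => 1) n =
       n%:R `^ (- (Num.min alpha beta / (2 * alpha + 2 * p + 1))))
  /\
  (* (ii) beta <= 2alpha+2p+1 and rho_n ~ n^{(alpha-beta)/(2beta+2p+1)} *)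
  (beta <= 2 * alpha + 2 * p + 1 ->
   forall rho : nat -> R, (forall n, 0 < rho n) ->
     asymp_seq rho (fun n => n%:R `^ ((alpha - beta) / (2 * beta + 2 * p + 1))) ->
     asymp_seq (eps_rate alpha beta p rho)
               (fun n => n%:R `^ (- (beta / (2 * beta + 2 * p + 1)))))
  /\
  (* (iii) beta > 2alpha+2p+1: eps_n >> n^{-beta/(2beta+2p+1)} for every scaling *)
  (2 * alpha + 2 * p + 1 < beta ->
   forall rho : nat -> R, (forall n, 0 < rho n) ->
     (fun n => n%:R `^ (- (beta / (2 * beta + 2 * p + 1))) / eps_rate alpha beta p rho n)
       @ \oo --> 0).
Proof.
move=> a0 p0 aasymp psiM AopE b0 bp al0 iidP iidQ.
split; last first.
  split; first by move=> n n1; exact: eps_rate_rho1.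
  split; first by move=> bq rho rho0; exact: eps_rate_optimal.
  by move=> qb rho rho0; exact: eps_rate_suboptimal.
move=> rho rho0 Soo K Mn K0 Mnoo.
have AopE' f : in_Sbeta beta f -> forall x : R, x \in `[0, 1] ->
    (fun N => \sum_(1 <= k < N) a k * f k * psi k x) @ \oo --> Aop f x.
  by move=> /AopE[].
have [C C0 risk] := posterior_risk_le p0 b0 bp al0 psiM a0 aasymp AopE' K0.
have eps0 n : (0 < n)%N -> 0 < eps_rate alpha beta p rho n.
  move=> n0; rewrite /eps_rate lt_max powR_gt0// mulr_gt0 ?exprn_gt0//.
  by rewrite ltr0n.
have Mn0 : \forall n \near \oo, 0 < Mn n by move/cvgryPgt : Mnoo; exact.
apply: (@squeeze_cvge _ _ _ _ (fun=> 0%E) _ (fun n => (C * ((Mn n)^-1 * (Mn n)^-1))%:E)).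
- near=> n.
  have n2 : (2 <= n)%N by near: n; exists 2%N.
  have n0 : (0 < n)%N by exact: ltn_trans n2.
  (* Divergence of [rho_n^2 n] enters here, to reach the range where the risk bound holds. *)
  have S1 : 1 <= rho n ^+ 2 * n%:R by near: n; move/cvgryPge : Soo; exact.
  have Mn' : 0 < Mn n by near: n.
  have e0 := eps0 n n0.
  apply/andP; split.
    apply: le_trans (ereal_sup_ubound _); last first.
      by exists (fun=> 0) => //; exact: Sbeta_ball0.
    by apply: integral_ge0 => w _; rewrite /post_prob.
  apply: ge_ereal_sup => _ [f fK <-].
  have r0 : 0 < Mn n * eps_rate alpha beta p rho n by rewrite mulr_gt0.
  have psi1 k : (1 <= k < n)%N -> dinner n (psi k) (psi k) = 1.
    by move=> kn; rewrite (psiM.1 n)// eqxx.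
  have cf := Sbeta_tail_cvg (ltW b0) K0 n0 fK.
  apply: le_trans (exp_post_prob_le a rho alpha (Aop f) iidP iidQ n0 r0 cf psi1) _.
  rewrite lee_fin; apply: le_trans (ler_wpM2l _ (risk rho n f (rho0 n) n2 S1 fK)) _.
    by rewrite invr_ge0 sqr_ge0.
  rewrite le_eqVlt; apply/orP; left; apply/eqP.
  by field; rewrite !gt_eqF.
- exact: cvg_cst.
- apply: cvg_EFin; first exact: nearW.
  rewrite [X in _ --> X](_ : 0 = C * (0 * 0)); last by rewrite !mulr0.
  have Mi : (fun n => (Mn n)^-1) @ \oo --> 0 by exact/(gtr0_cvgV0 Mn0).
  by apply: cvgM; [exact: cvg_cst|exact: cvgM].
Unshelve. all: by end_near. Qed.
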